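(* Let $(G,\Omega)$ and $(H,\Lambda)$ be abundant transitive $\ell$-permutation groups, both satisfying $(\dagger)$, and suppose that every o-primitive component $(G(\Delta),\pi(\Delta))$ ($\Delta\in T_G$) of $(G,\Omega)$ contains an irreducible element. If $G\equiv H$, then every o-primitive component of $(H,\Lambda)$ contains an irreducible element, and the spines $\mathfrak K_G$ and $\mathfrak K_H$ are elementarily equivalent as totally ordered sets. If in addition $(G,\Omega)$ is controlled, then the coloured chains $\mathfrak C_G$ and $\mathfrak C_H$ are elementarily equivalent as coloured chains.
   Context: An $\ell$-permutation group $(G,\Omega)$ is a totally ordered set $(\Omega,\leqslant)$ together with a subgroup $G$ of $\mathrm{Aut}(\Omega,\leqslant)$ (acting on the right) closed under the pointwise operations $\alpha(f\vee g)=\max\{\alpha f,\alpha g\}$, $\alpha(f\wedge g)=\min\{\alpha f,\alpha g\}$; it is transitive if $G$ is transitive on $\Omega$. $\mathrm{supp}(g)=\{\alpha:\alpha g\neq\alpha\}$. $G\equiv H$ means $G,H$ satisfy the same first-order sentences in the language of lattice-ordered groups ($\cdot,{}^{-1},1,\vee,\wedge$). A convex congruence of a transitive $(G,\Omega)$ is a $G$-invariant equivalence relation on $\Omega$ with convex classes (o-blocks); these are totally ordered by inclusion. For $\alpha\neq\beta$, $V(\alpha,\beta)$ is the intersection of all convex congruences in which $\alpha,\beta$ are in the same class, and $U(\alpha,\beta)$ the union of those in which they are in different classes; $V(\alpha,\beta)$ covers $U(\alpha,\beta)$. The spine is $\mathfrak K_G=\{V(\alpha,\beta):\alpha\neq\beta\}$,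 totally ordered by inclusion; for $\mathcal C=V(\alpha,\beta)\in\mathfrak K_G$, $\pi(\mathcal C)=U(\alpha,\beta)$ (depends only on $\mathcal C$). $T=T_G$ is the set of all classes of members of $\mathfrak K_G$, partially ordered by inclusion; for $\Delta\in T$, $\kappa(\Delta)$ is the member of $\mathfrak K_G$ having $\Delta$ as a class, and $\pi(\Delta)$ is the set of $\pi(\kappa(\Delta))$-classes contained in $\Delta$, ordered by the order of $\Omega$. $\mathrm{st}(\Delta)=\{g:\Delta g=\Delta\}$, $\mathrm{rst}(\Delta)=\{g:\mathrm{supp}(g)\subseteq\Delta\}$. $G(\Delta)$ is the group of permutations of $\pi(\Delta)$ induced by $\mathrm{st}(\Delta)$; $(G(\Delta),\pi(\Delta))$ is a transitive o-primitive $\ell$-permutation group, an o-primitive component. For $K\in\mathfrak K_G$, $G_K$ denotes $G(\Delta)$ for any class $\Delta$ of $K$ (well defined up to isomorphism). For $\Delta\in T$, $Q_\Delta=\{h\in\mathrm{rst}(\Delta):\exists\alpha\in\Delta,\ V(\alpha,\alpha h)=\kappa(\Delta)\}$. For $g$ with $\Lambda g=\Lambda$, $\mathrm{dep}(g,\Lambda)$ is the automorphism of $\Omega$ equal to $g$ on $\Lambda$ and the identity elsewhere. $(G,\Omega)$ is abundant if $\mathrm{dep}(g,\Delta)\in G$ for all $\Delta\in T$, $g\in\mathrm{st}(\Delta)$. $(\dagger)$: if $\Delta$ is a minimal element of $T$, then for all $\alpha<\beta$ in $\Delta$ there is $1\neq g\in G$ with $\mathrm{supp}(g)\subseteq\{\omega:\alpha<\omega<\beta\}$.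 An element $g$ of an $\ell$-group is irreducible if $g>1$ and whenever $g_1\vee g_2=g$ and $g_1\wedge g_2=1$ then $g_1=1$ or $g_2=1$. $(G,\Omega)$ is controlled if for every non-minimal $\Delta\in T$ and every $g\in\mathrm{rst}(\Delta)$, either $V(\delta,\delta g)=\kappa(\Delta)$ for some $\delta\in\Delta\cap\mathrm{supp}(g)$, or there is $\Delta'\in T$ with $\mathrm{supp}(g)\subseteq\Delta'\subsetneq\Delta$. The coloured chain $\mathfrak C_G$ is the totally ordered set $\mathfrak K_G$ together with unary predicates $P_\sigma$, one for each first-order sentence $\sigma$ of the language of $\ell$-groups, where $P_\sigma(K)$ holds iff $G_K\models\sigma$. *)

(* Defs.v *)
From HB Require Import structures.
From mathcomp Require Import all_boot all_order.
From Stdlib Require Import ClassicalEpsilon.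
Set Implicit Arguments. Unset Strict Implicit. Unset Printing Implicit Defensive.
Import Order.TTheory.
Local Open Scope order_scope.

Inductive lterm :=
| TVar of nat | TOne | TMul of lterm & lterm | TInv of lterm
| TJoin of lterm & lterm | TMeet of lterm & lterm.

Inductive lform :=
| LEq of lterm & lterm | LBot | LNot of lform | LAnd of lform & lform
| LOr of lform & lform | LImp of lform & lform
| LAll of nat & lform | LEx of nat & lform.

Fixpoint tfree (n : nat) (t : lterm) : bool :=
  match t with
  | TVar m => m == n
  | TOne => false
  | TMul a b | TJoin a b | TMeet a b => tfree n a || tfree n b
  | TInv a => tfree n a
  end.

Fixpoint lfree (n : nat) (f : lform) : bool :=
  match f with
  | LEq a b => tfree n a || tfree n b
  | LBot => false
  | LNot p => lfree n p
  | LAnd p q | LOr p q | LImp p q => lfree n p || lfree n q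
  | LAll m p | LEx m p => (m != n) && lfree n p
  end.

Definition lsentence (f : lform) : Prop := forall n, lfree n f = false.

(* An l-group structure, presented as a domain [ls_dom] inside a carrier
   type, with an equality relation [ls_eq] (a congruence) and total
   operations; quantifiers range over the domain. *)
Record lstruct := LStruct {
  ls_car : Type;
  ls_dom : ls_car -> Prop;
  ls_eq : ls_car -> ls_car -> Prop;
  ls_one : ls_car;
  ls_mul : ls_car -> ls_car -> ls_car;
  ls_inv : ls_car -> ls_car;
  ls_join : ls_car -> ls_car -> ls_car;
  ls_meet : ls_car -> ls_car -> ls_car }.

Definition upd {A : Type} (env : nat -> A) (n : nat) (a : A) : nat -> A :=
  fun k => if k == n then a else env k.

Fixpoint leval (M : lstruct) (env : nat -> ls_car M) (t : lterm) : ls_car M :=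
  match t with
  | TVar m => env m
  | TOne => ls_one M
  | TMul a b => ls_mul (leval env a) (leval env b)
  | TInv a => ls_inv (leval env a)
  | TJoin a b => ls_join (leval env a) (leval env b)
  | TMeet a b => ls_meet (leval env a) (leval env b)
  end.

Fixpoint lsat (M : lstruct) (env : nat -> ls_car M) (f : lform) : Prop :=
  match f with
  | LEq a b => ls_eq (leval env a) (leval env b)
  | LBot => False
  | LNot p => ~ lsat env p
  | LAnd p q => lsat env p /\ lsat env q
  | LOr p q => lsat env p \/ lsat env q
  | LImp p q => lsat env p -> lsat env q
  | LAll m p => forall a, ls_dom a -> lsat (upd env m a) p
  | LEx m p => exists a, ls_dom a /\ lsat (upd env m a) p
  end.

Definition lmodels (M : lstruct) (f : lform) : Prop :=
  forall env : nat -> ls_car M, (forall n, ls_dom (env n)) -> lsat env f.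

Definition lequiv (M N : lstruct) : Prop :=
  forall f, lsentence f -> (lmodels M f <-> lmodels N f).

Definition ls_le (M : lstruct) (a b : ls_car M) : Prop := ls_eq (ls_join a b) b.

Definition irreducible (M : lstruct) (g : ls_car M) : Prop :=
  (ls_le (ls_one M) g /\ ~ ls_eq g (ls_one M)) /\
  forall g1 g2, ls_dom g1 -> ls_dom g2 ->
    ls_eq (ls_join g1 g2) g -> ls_eq (ls_meet g1 g2) (ls_one M) ->
    ls_eq g1 (ls_one M) \/ ls_eq g2 (ls_one M).

Inductive cform (I : Type) :=
| CLe of nat & nat | CEq of nat & nat | CP of I & nat | CBot
| CNot of cform I | CAnd of cform I & cform I | COr of cform I & cform I
| CImp of cform I & cform I | CAll of nat & cform I | CEx of nat & cform I.

Fixpoint cfree (I : Type) (n : nat) (f : cform I) : bool :=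
  match f with
  | CLe a b | CEq a b => (a == n) || (b == n)
  | CP _ a => a == n
  | CBot => false
  | CNot p => cfree n p
  | CAnd p q | COr p q | CImp p q => cfree n p || cfree n q
  | CAll m p | CEx m p => (m != n) && cfree n p
  end.

Definition csentence (I : Type) (f : cform I) : Prop := forall n, cfree n f = false.

Record cstruct (I : Type) := CStruct {
  cs_car : Type;
  cs_dom : cs_car -> Prop;
  cs_eq : cs_car -> cs_car -> Prop;
  cs_le : cs_car -> cs_car -> Prop;
  cs_pred : I -> cs_car -> Prop }.

Fixpoint csat (I : Type) (M : cstruct I) (env : nat -> cs_car M) (f : cform I)
  : Prop :=
  match f with
  | CLe a b => cs_le (env a) (env b)
  | CEq a b => cs_eq (env a) (env b)
  | CP i a => cs_pred i (env a)
  | CBot => False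
  | CNot p => ~ csat env p
  | CAnd p q => csat env p /\ csat env q
  | COr p q => csat env p \/ csat env q
  | CImp p q => csat env p -> csat env q
  | CAll m p => forall a, cs_dom a -> csat (upd env m a) p
  | CEx m p => exists a, cs_dom a /\ csat (upd env m a) p
  end.

Definition cmodels (I : Type) (M : cstruct I) (f : cform I) : Prop :=
  forall env : nat -> cs_car M, (forall n, cs_dom (env n)) -> csat env f.

Definition cequiv (I : Type) (M N : cstruct I) : Prop :=
  forall f : cform I, csentence f -> (cmodels M f <-> cmodels N f).

Section LPerm.
Context {disp : Order.disp_t} {O : orderType disp}.

Definition is_oaut (f : O -> O) : Prop :=
  bijective f /\ {mono f : x y / x <= y}.

(* G is a subgroup of Aut(O,<=), with the right action  x(fg) = (xf)g,
   closed under pointwise max / min. *)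
Record lperm := LPerm {
  lp_mem : (O -> O) -> Prop;
  lp_aut : forall f, lp_mem f -> is_oaut f;
  lp_id : lp_mem id;
  lp_mul : forall f g, lp_mem f -> lp_mem g -> lp_mem (g \o f);
  lp_inv : forall f, lp_mem f -> exists g, lp_mem g /\ cancel f g /\ cancel g f;
  lp_join : forall f g, lp_mem f -> lp_mem g ->
      lp_mem (fun x => Order.max (f x) (g x));
  lp_meet : forall f g, lp_mem f -> lp_mem g ->
      lp_mem (fun x => Order.min (f x) (g x)) }.

Variable G : lperm.

Definition finv (f : O -> O) : O -> O :=
  epsilon (inhabits f) (fun g => cancel f g /\ cancel g f).

Definition mulf (f g : O -> O) : O -> O := g \o f.   (* x(fg) = (xf)g *)
Definition joinf (f g : O -> O) : O -> O := fun x => Order.max (f x) (g x).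
Definition meetf (f g : O -> O) : O -> O := fun x => Order.min (f x) (g x).

Definition lgroup : lstruct :=
  @LStruct (O -> O) (lp_mem G) (fun f g => forall x, f x = g x)
    id mulf finv joinf meetf.

Definition ltransitive : Prop :=
  forall a b : O, exists g, lp_mem G g /\ g a = b.

Definition supp (g : O -> O) : O -> Prop := fun x => g x <> x.

Definition convex_congruence (E : O -> O -> Prop) : Prop :=
  [/\ (forall x, E x x), (forall x y, E x y -> E y x),
      (forall x y z, E x y -> E y z -> E x z),
      (forall g, lp_mem G g -> forall x y, E x y -> E (g x) (g y)) &
      (forall x y z, x <= y -> y <= z -> E x z -> E x y)].

Definition Vc (a b : O) : O -> O -> Prop :=
  fun x y => forall E, convex_congruence E -> E a b -> E x y.
Definition Uc (a b : O) : O -> O -> Prop :=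
  fun x y => exists E, convex_congruence E /\ ~ E a b /\ E x y.

Definition same_rel (R S : O -> O -> Prop) : Prop := forall x y, R x y <-> S x y.

Definition in_spine (R : O -> O -> Prop) : Prop :=
  exists a b, a <> b /\ same_rel R (Vc a b).

Definition piK (R : O -> O -> Prop) : O -> O -> Prop :=
  fun x y => exists a b, [/\ a <> b, same_rel R (Vc a b) & Uc a b x y].

Definition in_T (D : O -> Prop) : Prop :=
  exists R, in_spine R /\ exists a, forall x, D x <-> R a x.

Definition proper_sub (D' D : O -> Prop) : Prop :=
  (forall x, D' x -> D x) /\ exists x, D x /\ ~ D' x.

Definition minimal_T (D : O -> Prop) : Prop :=
  in_T D /\ ~ exists D', in_T D' /\ proper_sub D' D.

Definition st (D : O -> Prop) (g : O -> O) : Prop :=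
  lp_mem G g /\ forall y, D y <-> exists x, D x /\ g x = y.

Definition rst (D : O -> Prop) (g : O -> O) : Prop :=
  lp_mem G g /\ forall x, supp g x -> D x.

(* the o-primitive component G(D), for the class D = {x | R a x} of R in
   the spine: elements of st(D), two of them being identified when they
   induce the same permutation of pi(D) (the pi(R)-classes inside D). *)
Definition component (R : O -> O -> Prop) (a : O) : lstruct :=
  @LStruct (O -> O) (st (R a))
    (fun g h => forall x, R a x -> forall y,
        (exists z, piK R x z /\ g z = y) <-> (exists z, piK R x z /\ h z = y))
    id mulf finv joinf meetf.

Definition abundant : Prop :=
  forall D, in_T D -> forall g, st D g ->
    exists h, lp_mem G h /\ forall x, (D x -> h x = g x) /\ (~ D x -> h x = x).

Definition dagger : Prop :=
  forall D, minimal_T D -> forall a b, D a -> D b -> a < b ->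
    exists g, lp_mem G g /\ (exists x, g x <> x) /\
      forall x, supp g x -> a < x < b.

Definition irreducible_components : Prop :=
  forall R, in_spine R -> forall a,
    exists g, st (R a) g /\ @irreducible (component R a) g.

Definition controlled : Prop :=
  forall R, in_spine R -> forall a, ~ minimal_T (R a) ->
    forall g, rst (R a) g ->
      (exists d, [/\ R a d, supp g d & same_rel (Vc d (g d)) R]) \/
      (exists D', [/\ in_T D', (forall x, supp g x -> D' x) & proper_sub D' (R a)]).

Definition spine_cstruct (I : Type) (col : I -> (O -> O -> Prop) -> Prop)
  : cstruct I :=
  @CStruct I (O -> O -> Prop) in_spine same_rel
    (fun R S => forall x y, R x y -> S x y) col.

Definition spine_chain : cstruct False :=
  spine_cstruct (fun (i : False) _ => match i with end).

Definition lsent := {f : lform | lsentence f}.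

(* the coloured chain C_G: P_sigma(K) iff G_K |= sigma, G_K = G(D) for
   (any, equivalently every) class D of K *)
Definition coloured_chain : cstruct lsent :=
  spine_cstruct (fun s R => forall a, lmodels (component R a) (proj1_sig s)).

End LPerm.
Arguments lperm {disp} O.

(* Main.v *)
(* The tree T is interpretable in the l-group G, uniformly in all abundant
   transitive G.  Disjointness of supports is expressed by |f| /\ |g| = 1.  If
   h >= 1 is supported in D = V(a,ah)-class of a, then D is the union of the
   supports of a definable set of conjugates of h, so rst(D) is the double polar
   of that set.  A parameter h arising in this way may be recognised: a double
   polar is rst of an o-block if and only if every conjugate of it is equal to it
   or disjoint from it and its stabiliser is a convex sublattice, and an o-block
   X is in T if and only if two of its points lie in no smaller block.  Inclusion
   up to conjugacy interprets the spine, and the kernel of st(D) -> G(D) is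
   definable through the blocks below D.  Sentences about the spine, the coloured
   chain and the components are thus translated into sentences about G, by
   formulas that do not depend on G. *)
Require Import Defs.
From HB Require Import structures.
From mathcomp Require Import all_boot all_order.
From mathcomp Require Import zify.
From Stdlib Require Import Classical ClassicalEpsilon FunctionalExtensionality PropExtensionality.
Import Defs.
Set Implicit Arguments. Unset Strict Implicit. Unset Printing Implicit Defensive.
Import Order.TTheory.
Local Open Scope order_scope.

(** * The tree of classes inside the l-group *)

Section Perm.
Context {disp : Order.disp_t} {O : orderType disp}.
Implicit Types (f g h k m w : O -> O) (x y z a b p : O) (X Y D : O -> Prop).
Implicit Types E R : O -> O -> Prop.

Definition dj f g : Prop := forall x, f x = x \/ g x = x.
Definition lef f g : Prop := forall x, f x <= g x.
Definition cj h g : O -> O := mulf (mulf (finv g) h) g.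

Context (G : lperm O).
Local Notation "f \inG" := (lp_mem G f) (at level 70).

Lemma finvP f : f \inG -> cancel f (finv f) /\ cancel (finv f) f.
Proof.
move=> Gf; have [g [_ fgK]] := lp_inv Gf.
by apply: (epsilon_spec (inhabits f) (fun g => cancel f g /\ cancel g f)); exists g.
Qed.

Lemma finvK f : f \inG -> cancel f (finv f). Proof. by case/finvP. Qed.
Lemma finvKV f : f \inG -> cancel (finv f) f. Proof. by case/finvP. Qed.

Lemma mem_finv f : f \inG -> finv f \inG.
Proof.
move=> Gf; have [g [Gg [fK gK]]] := lp_inv Gf.
suff -> : finv f = g by [].
by apply: functional_extensionality => x; rewrite -{1}(gK x) finvK.
Qed.

Lemma mem_mulf f g : f \inG -> g \inG -> mulf f g \inG.
Proof. exact: lp_mul. Qed.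
Lemma mem_joinf f g : f \inG -> g \inG -> joinf f g \inG.
Proof. exact: lp_join. Qed.
Lemma mem_meetf f g : f \inG -> g \inG -> meetf f g \inG.
Proof. exact: lp_meet. Qed.
Lemma mem_cj h g : h \inG -> g \inG -> cj h g \inG.
Proof. by move=> Gh Gg; apply/mem_mulf => //; apply/mem_mulf => //; apply: mem_finv. Qed.

Lemma mono_le f x y : f \inG -> (f x <= f y) = (x <= y).
Proof. by move=> /lp_aut[_ ->]. Qed.
Lemma mono_lt f x y : f \inG -> (f x < f y) = (x < y).
Proof. by move=> Gf; rewrite !ltNge mono_le. Qed.
Lemma mem_inj f : f \inG -> injective f.
Proof. by move=> Gf; apply: can_inj (finvK Gf). Qed.

Lemma cjE h g x : g \inG -> cj h g (g x) = g (h x).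
Proof. by move=> Gg; rewrite /cj /mulf /= finvK. Qed.

Lemma cj_moves h g x : g \inG -> (cj h g x = x) <-> (h (finv g x) = finv g x).
Proof.
move=> Gg; rewrite -{1 2}(finvKV Gg x) cjE //; split=> [|-> //].
exact: mem_inj.
Qed.

Lemma finv_id : finv (@id O) = id.
Proof. by apply: functional_extensionality => x; have := finvK (lp_id G) x. Qed.

Lemma cj_id h : cj h id = h.
Proof. by rewrite /cj finv_id. Qed.

Lemma finv_fix f x : f \inG -> f x = x -> finv f x = x.
Proof. by move=> Gf fx; rewrite -{1}fx finvK. Qed.

Context (trG : ltransitive G).

(** Joining a transporting element with the identity makes it positive without changing its value at
    [a]. *)
Lemma push a b : a <= b -> exists g, [/\ g \inG, lef id g & g a = b].
Proof.
move=> ab; have [g [Gg gab]] := trG a b.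
exists (joinf id g); split; first exact: mem_joinf (lp_id G) Gg.
  by move=> x; rewrite /joinf le_max lexx.
by rewrite /joinf /= gab max_r.
Qed.

Lemma push_below k a b : k \inG -> lef id k -> a <= b -> b <= k a ->
  exists m, [/\ m \inG, lef id m, lef m k & m a = b].
Proof.
move=> Gk k1 ab bk; have [g [Gg g1 gab]] := push ab.
exists (meetf g k); split; first exact: mem_meetf.
- by move=> x; rewrite /meetf le_min g1 k1.
- by move=> x; rewrite /meetf ge_min lexx orbT.
by rewrite /meetf gab min_l.
Qed.

(** * Blocks and convex congruences *)

Definition block X : Prop :=
  [/\ (exists x, X x),
      (forall g, g \inG -> forall x, X x -> X (g x) -> forall y, X y -> X (g y)) &
      (forall x y z, x <= y -> y <= z -> X x -> X z -> X y)].

(** Its classes are the translates of the block X, so a single block yields the convex congruence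
    having it as a class. *)
Definition blockrel X : O -> O -> Prop :=
  fun x y => exists g, [/\ g \inG, X (g x) & X (g y)].

(** The invariance clause of [block] concerns images only; applied to the inverse of [g] it handles
    preimages. *)
Lemma block_inv X g y : block X -> g \inG -> forall x, X x -> X (g x) -> X (g y) -> X y.
Proof.
move=> [_ st _] Gg x Xx Xgx Xgy; rewrite -(finvK Gg y).
by apply: st Xgy; [exact: mem_finv | exact: Xgx | rewrite finvK].
Qed.

Lemma blockrel_class X x y : block X -> X x -> (blockrel X x y <-> X y).
Proof.
move=> bX Xx; split=> [[g [Gg Xgx Xgy]]|Xy]; first exact: (block_inv bX Gg Xx Xgx Xgy).
by exists id; split => //; exact: lp_id.
Qed.

Lemma blockrel_cc X : block X -> convex_congruence G (blockrel X).
Proof.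
move=> bX; have [[c Xc] st cvx] := bX; split.
- by move=> x; have [g [Gg gx]] := trG x c; exists g; rewrite gx.
- by move=> x y [g [Gg Xx Xy]]; exists g.
- move=> x y z [g [Gg Xx Xy]] [k [Gk Xky Xkz]]; exists g; split=> //.
  have GG := mem_mulf (mem_finv Gg) Gk.
  have GE u : mulf (finv g) k (g u) = k u by rewrite /mulf /= finvK.
  by apply: (block_inv bX GG Xy); rewrite GE.
- move=> k Gk x y [g [Gg Xx Xy]].
  by exists (mulf (finv k) g); split; [apply: mem_mulf => //; exact: mem_finv | |];
    rewrite /mulf /= finvK.
- move=> x y z xy yz [g [Gg Xx Xz]]; exists g; split=> //.
  by apply: (cvx _ _ _ _ _ Xx Xz); rewrite mono_le.
Qed.

Lemma cc_class E a : convex_congruence G E -> block (E a).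
Proof.
move=> [Er Es Et Ei Ec]; split; first by exists a.
  move=> g Gg x ax agx y ay; apply: (Et _ _ _ agx); apply: Ei => //.
  exact: (Et _ _ _ (Es _ _ ax) ay).
move=> x y z xy yz ax az; apply: (Et _ _ _ ax); apply: Ec xy yz _.
exact: (Et _ _ _ (Es _ _ ax) az).
Qed.

(** Otherwise there are x <= y related by E only and x' <= y' related by F only. Transitivity moves
    x' to x, and by convexity the pair with the nearer upper end lies in both relations. *)
Lemma cc_total E F : convex_congruence G E -> convex_congruence G F ->
  (forall x y, E x y -> F x y) \/ (forall x y, F x y -> E x y).
Proof.
move=> ccE ccF; apply: NNPP => /not_or_and[nEF nFE].
have wit A B : convex_congruence G A -> convex_congruence G B ->
    ~ (forall x y, A x y -> B x y) -> exists x y, [/\ x <= y, A x y & ~ B x y].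
  move=> [_ As _ _ _] [_ Bs _ _ _] /not_all_ex_not[x /not_all_ex_not[y nAB]].
  have [Axy nBxy] := imply_to_and _ _ nAB.
  case: (leP x y) => [xy|/ltW yx]; first by exists x, y.
  by exists y, x; split=> //; [exact: As | move/Bs].
have [x [y [xy Exy nFxy]]] := wit _ _ ccE ccF nEF.
have [x' [y' [xy' Fxy' nExy']]] := wit _ _ ccF ccE nFE.
case: ccE ccF => [_ _ _ Ei Ec] [_ _ _ Fi Fc].
have [g [Gg gx]] := trG x' x.
have Fxg : F x (g y') by rewrite -gx; exact: Fi.
have nExg : ~ E x (g y').
  move=> /(Ei _ (mem_finv Gg)); rewrite -{1}gx !finvK //.
have xg : x <= g y' by rewrite -gx mono_le.
case: (leP y (g y')) => [le|/ltW le]; first by apply/nFxy/(Fc _ _ _ xy le).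
by apply: nExg; exact: Ec xg le Exy.
Qed.

Lemma block_total X Y x : block X -> block Y -> X x -> Y x ->
  (forall y, X y -> Y y) \/ (forall y, Y y -> X y).
Proof.
move=> bX bY Xx Yx; have eX := blockrel_class _ bX Xx.
have eY := blockrel_class _ bY Yx.
by case: (cc_total (blockrel_cc bX) (blockrel_cc bY)) => le; [left|right] => y;
  [move/eX/le/eY | move/eY/le/eX].
Qed.

Lemma Vc_cc a b : convex_congruence G (Vc G a b).
Proof.
split.
- by move=> x E [Er _ _ _ _] _.
- by move=> x y V E cE ab; case: (cE) => _ Es _ _ _; apply: (Es); exact: V.
- by move=> x y z V V' E cE ab; case: (cE) => _ _ Et _ _; apply: (Et _ y); [exact: V | exact: V'].
- by move=> g Gg x y V E cE ab; case: (cE) => _ _ _ Ei _; apply: (Ei) => //; exact: V.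
- by move=> x y z xy yz V E cE ab; case: (cE) => _ _ _ _ Ec; apply: (Ec _ _ _ xy yz); exact: V.
Qed.

Lemma Vc_ab a b : Vc G a b a b. Proof. by []. Qed.

Lemma same_rel_cc R S : same_rel R S -> convex_congruence G R -> convex_congruence G S.
Proof.
move=> RS [Rr Rs Rt Ri Rc]; split.
- by move=> x; apply/RS.
- by move=> x y /RS/Rs/RS.
- by move=> x y z /RS xy /RS yz; apply/RS/(Rt _ _ _ xy yz).
- by move=> g Gg x y /RS xy; apply/RS/Ri.
- by move=> x y z xy yz /RS xz; apply/RS/(Rc _ _ _ xy yz).
Qed.

Lemma spine_cc R : in_spine G R -> convex_congruence G R.
Proof.
move=> [a [b [_ RV]]]; apply: same_rel_cc (Vc_cc a b).
by move=> x y; split=> /RV.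
Qed.

(* For a block X: X is the V(a,b)-class of a. *)
Definition spans X a b : Prop :=
  [/\ X a, X b, a <> b & forall Y, block Y -> Y a -> Y b -> forall x, X x -> Y x].

Lemma spans_cc X a b E : spans X a b -> convex_congruence G E -> E a b ->
  forall x y, X x -> X y -> E x y.
Proof.
move=> [Xa Xb _ min] cE Eab x y Xx Xy.
have [Er Es Et _ _] := cE.
have b_Ea := cc_class a cE.
by apply: (Et _ a); [apply: Es; exact: (min _ b_Ea) | exact: (min _ b_Ea)].
Qed.

Lemma stab_block D g : block D -> g \inG -> forall x y, D x -> D y -> g x = y ->
  forall z, D z -> D (g z).
Proof. by move=> [_ st _] Gg x y Dx Dy gx; apply: (st g Gg x); rewrite ?gx. Qed.

(** Says that z is at most the image of x under some product of n conjugates of h. The inequality in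
    the base case makes the reached points an initial segment. *)
Fixpoint reach h n x z : Prop :=
  if n is n'.+1 then exists g, g \inG /\ reach h n' (cj h g x) z else z <= x.

(** * Points reached by successive conjugates *)

Section Reach.
Context (h : O -> O) (Gh : h \inG) (h1 : lef id h).

Lemma lef_cj g : g \inG -> lef id (cj h g).
Proof.
by move=> Gg x; rewrite -(finvKV Gg x) cjE // /= mono_le.
Qed.

Lemma reach_up n x x' z : x <= x' -> reach h n x z -> reach h n x' z.
Proof.
elim: n x x' => [|n IH] x x' xx' /= => [zx|[g [Gg r]]]; first exact: le_trans zx xx'.
by exists g; split=> //; apply: IH r; rewrite mono_le //; exact: mem_cj.
Qed.

Lemma reach_down n x z z' : z' <= z -> reach h n x z -> reach h n x z'.
Proof.
move=> zz'; elim: n x => [|n IH] x /= => [|[g [Gg r]]]; first exact: le_trans.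
by exists g; split=> //; exact: IH.
Qed.

Lemma reachD n (m : nat) x z : reach h (n + m) x z <-> exists y, reach h n x y /\ reach h m y z.
Proof.
elim: n x => [|n IH] x /=.
  by split=> [r|[y [yx r]]]; [exists x | exact: reach_up r].
split=> [[g [Gg /IH[y [r1 r2]]]]|[y [[g [Gg r1]] r2]]].
  by exists y; split=> //; exists g.
by exists g; split=> //; apply/IH; exists y.
Qed.

(** Conjugation by k permutes the conjugates of h. *)
Lemma reach_inv n k x z : k \inG -> reach h n x z -> reach h n (k x) (k z).
Proof.
move=> Gk; elim: n x => [|n IH] x /= => [|[g [Gg /IH r]]]; first by rewrite mono_le.
exists (mulf g k); split; first exact: mem_mulf.
suff -> : cj h (mulf g k) (k x) = k (cj h g x) by [].
by rewrite -(finvKV Gg x) cjE // -[k (g _)]/(mulf g k _) cjE //; exact: mem_mulf.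
Qed.

Lemma reach_refl n x : reach h n x x.
Proof.
elim: n => [|n IH] /=; first exact: lexx.
by exists id; split; [exact: lp_id | rewrite cj_id; exact: reach_up (h1 x) IH].
Qed.

Definition mutual x y : Prop := (exists n, reach h n x y) /\ (exists n, reach h n y x).

Lemma mutual_cc : convex_congruence G mutual.
Proof.
split.
- by move=> x; split; exists 0; exact: lexx.
- by move=> x y [].
- move=> x y z [[n xy] [n' yx]] [[m yz] [m' zy]]; split.
    by exists (n + m); apply/reachD; exists y.
  by exists (m' + n'); apply/reachD; exists y.
- by move=> g Gg x y [[n xy] [n' yx]]; split; [exists n|exists n']; exact: reach_inv.
move=> x y z xy yz [[n xz] _]; split; last by exists 0.
by exists n; exact: reach_down xz.
Qed.

Definition merging x y : Prop := exists n, forall z, reach h n x z <-> reach h n y z.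

(** The first n steps determine the later ones, so agreement persists; transitivity of [merging]
    rests on this. *)
Lemma merge_up n (m : nat) x y : (forall z, reach h n x z <-> reach h n y z) ->
  forall z, reach h (n + m) x z <-> reach h (n + m) y z.
Proof.
by move=> e z; split=> /reachD[u [/e r r']]; apply/reachD; exists u.
Qed.

Lemma merging_cc : convex_congruence G merging.
Proof.
split.
- by move=> x; exists 0.
- by move=> x y [n e]; exists n => z; split=> /e.
- move=> x y z [n e] [m e']; exists (n + m) => u.
  apply: iff_trans (merge_up m e u) _; rewrite addnC; exact: merge_up.
- move=> g Gg x y [n e]; exists n => z.
  have tr u v : (forall z, reach h n u z -> reach h n v z) ->
      reach h n (g u) z -> reach h n (g v) z.
    move=> le /(reach_inv (mem_finv Gg)); rewrite finvK // => /le /(reach_inv Gg).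
    by rewrite finvKV.
  by split; apply: tr => u /e.
move=> x y z xy yz [n e]; exists n => u; split; first exact: reach_up.
by move=> r; apply/e; exact: reach_up r.
Qed.

(* Write D_n for the set of points reached from a in n steps.  Once D_n contains
   the fixed point p, above which h is trivial on D, h D_n = D_n; hence a and h a
   are identified by [merging], which is then everything on D.  If every
   step from x0 stayed below y0, then n+1 steps from x0 would reach no more than n
   steps from y0, so some n steps would reach all of D; descending on n, so would
   0 steps, but D has no maximum. *)
Lemma reach_block D a p : block D -> spans D a (h a) -> (forall x, h x <> x -> D x) ->
  D p -> (forall x, D x -> p <= x -> h x = x) ->
  forall x y, D x -> D y -> exists g, g \inG /\ y <= cj h g x.
Proof.
move=> bD sp supD Dp fixp x0 y0 Dx0 Dy0; apply: NNPP => nr.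
have [Da Dha aha _] := sp.
have mutD : forall x y, D x -> D y -> mutual x y.
  apply: (spans_cc sp mutual_cc); split; last by exists 0; exact: h1.
  by exists 1, id; split; [exact: lp_id | rewrite /= cj_id].
have mergeD : forall x y, D x -> D y -> merging x y.
  apply: (spans_cc sp merging_cc).
  have [[n rn] _] := mutD _ _ Da Dp; exists n => z; split; first exact: reach_up (h1 a).
  move=> /(reach_inv (mem_finv Gh)); rewrite finvK // => r.
  case: (leP p (finv h z)) => [pz|/ltW zp].
    suff e : z = finv h z by rewrite e.
    apply: NNPP => ne; have nf : h (finv h z) <> finv h z by rewrite finvKV.
    by apply: (nf); apply: (fixp _ _ pz); exact: supD.
  apply: reach_down rn; rewrite -(finvKV Gh z) -(fixp _ Dp (lexx p)).
  by rewrite mono_le.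
have step n z : reach h n.+1 x0 z -> reach h n y0 z.
  rewrite -add1n => /reachD[y [[g [Gg yg]] r]]; apply: reach_up r.
  rewrite leNgt; apply/negP => /ltW y0y; apply: nr; exists g; split=> //.
  exact: le_trans yg.
have [n e] := mergeD _ _ Dx0 Dy0.
have stab (m : nat) z : reach h (n + m) x0 z -> reach h n x0 z.
  elim: m z => [|m IH] z; first by rewrite addn0.
  rewrite addnS -addn1 => /reachD[y [/IH r r']]; apply/e/step.
  by rewrite -addn1; apply/reachD; exists y.
have : exists x, D x /\ forall z, D z -> reach h n x z.
  exists x0; split=> // z Dz; have [[m r] _] := mutD _ _ Dx0 Dz.
  apply: (stab m); rewrite addnC; apply/reachD; exists z; split=> //.
  exact: reach_refl.
elim: n {e stab} => [|n IH] [x [Dx all]].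
  have [g [Gg gax]] := trG a x.
  have /= := all _ (stab_block bD Gg Da Dx gax Dha).
  by rewrite -gax mono_le // => le; apply: aha; apply/eqP; rewrite eq_le le h1.
(* When n.+1 steps from x reach all of D, moving x to [x0] and applying [step] gives [y0] the same
   property with n steps. *)
apply: IH; exists y0; split=> // z Dz; apply: step.
have [g [Gg gx]] := trG x x0; rewrite -gx -(finvKV Gg z).
apply: reach_inv => //; apply: all.
apply: (stab_block bD (mem_finv Gg) Dx0 Dx) => //.
by rewrite -gx finvK.
Qed.

End Reach.

(* [pol h] is the double polar of the conjugates [gen h] of h; it consists of the
   elements of G supported in [hull h] ([polP]).  Conjugators m are taken below a
   conjugate of h, which reaches all of D when h is bounded above in D
   ([reach_block]), or below some g such that h and h^g are not disjoint, which
   gives all of st(D)^+ when h is unbounded above. *)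
Definition gen h f : Prop := exists m, m \inG /\ exists g, g \inG /\
  (lef id m /\ ((lef m (cj h g) \/ (lef m g /\ ~ dj (cj h g) h)) /\
   ((forall x, f x = cj h m x) \/ (forall x, f x = cj h (finv m) x)))).
Definition prp h k : Prop := forall f, f \inG -> gen h f -> dj f k.
Definition pol h f : Prop := forall k, k \inG -> prp h k -> dj k f.
Definition hull h x : Prop := exists f, [/\ f \inG, pol h f & f x <> x].

(** Disjointness is pointwise, so f belongs to a polar as soon as each point moved by f is moved by
    some member of it. *)
Lemma polP h f : f \inG -> (pol h f <-> forall x, f x <> x -> hull h x).
Proof.
move=> Gf; split=> [Sf x fx|sub k Gk pk x]; first by exists f.
case: (classic (f x = x)) => [|/sub[e [Ge Se ex]]]; [by right | left].
by case: (Se k Gk pk x).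
Qed.

(** * The double polar of a spanning element *)

Section Cover.
Context (h : O -> O) (D : O -> Prop) (a : O).
Context (Gh : h \inG) (h1 : lef id h) (bD : block D) (sp : spans D a (h a)).
Hypothesis supD : forall x, h x <> x -> D x.

(** The bound on m makes m map D into itself: either the conjugate of h above m fixes y, or g
    carries a point of D into D and so stabilises D, and m y lies between y and a point of D. *)
Lemma gen_supp f x : gen h f -> f x <> x -> D x.
Proof.
have [Da Dha aha _] := sp; have [_ st cvx] := bD.
have hD y : D y -> D (h y) by exact: (st h Gh a Da Dha).
move=> [m [Gm [g [Gg [m1 [mg fm]]]]]] fx.
have mD y : D y -> D (m y).
  move=> Dy; case: mg => [le|[le /not_all_ex_not[z /not_or_and[gz hz]]]].
    case: (classic (cj h g y = y)) => [e|ne].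
      have -> // : m y = y by apply/eqP; rewrite eq_le m1 -{2}e le.
    have Dg : D (finv g y) by apply: supD => /(cj_moves h y Gg).
    apply: (cvx y _ (cj h g y)) => //.
    rewrite -(finvKV Gg y) cjE //; apply: (st g Gg _ Dg); first by rewrite finvKV.
    exact: hD.
  have Dg : D (finv g z) by apply: supD => /(cj_moves h z Gg).
  apply: (cvx y _ (g y)) => //; apply: (st g Gg _ Dg) => //.
  by rewrite finvKV //; exact: supD.
case: fm => e; move: fx; rewrite e => /(cj_moves h x _) fx.
  have /mD : D (finv m x) by exact/supD/fx.
  by rewrite finvKV.
have GM := mem_finv Gm.
have /(block_inv bD Gm Da (mD _ Da)) // : D (m x).
suff -> : m x = finv (finv m) x by exact/supD/fx.
by apply: (mem_inj GM); rewrite finvK // finvKV.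
Qed.

(** An admissible conjugator carries a, which h moves, to p, or p to a when p lies below a; this is
    why [gen] admits both m and its inverse. *)
Lemma gen_cover p : D p -> exists f, [/\ f \inG, gen h f & f p <> p].
Proof.
have [Da Dha aha _] := sp.
have H x y : D x -> D y -> x <= y -> exists m, [/\ m \inG, lef id m, m x = y &
    exists g, g \inG /\ (lef m (cj h g) \/ (lef m g /\ ~ dj (cj h g) h))].
  move=> Dx Dy xy.
  case: (classic (exists q, D q /\ forall x, D x -> q <= x -> h x = x)).
    move=> [q [Dq fixq]].
    have [g [Gg yg]] := reach_block Gh h1 bD sp supD Dq fixq Dx Dy.
    have [m [Gm m1 mg mx]] := push_below (mem_cj Gh Gg) (lef_cj h1 Gg) xy yg.
    by exists m; split=> //; exists g; split=> //; left.
  move=> unb; have [m [Gm m1 mx]] := push xy.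
  exists m; split=> //.
  have Dma : D (m a) by exact: (stab_block bD Gm Dx Dy mx).
  have [q [Dq mq hq]] : exists q, [/\ D q, m a <= q & h q <> q].
    apply: NNPP => nq; apply: unb; exists (m a); split=> // z Dz mz.
    by apply: NNPP => hz; apply: nq; exists z.
  (* The join of k and m sends a to q, so the conjugate of h by it moves q, as h does. The join
     therefore serves as the bound g. *)
  have [k [Gk k1 ka]] := push (le_trans (m1 a) mq).
  exists (joinf k m); split; first exact: mem_joinf.
  have ja : joinf k m a = q by rewrite /joinf ka max_l.
  right; split; first by move=> z; rewrite /joinf le_max lexx orbT.
  move=> /(_ q) [|//]; rewrite -ja cjE; last exact: mem_joinf.
  by move=> /(mem_inj (mem_joinf Gk Gm))/esym.
move=> Dp; case: (leP a p) => [ap|/ltW pa].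
  have [m [Gm m1 ma [g [Gg mg]]]] := H _ _ Da Dp ap.
  exists (cj h m); split; first exact: mem_cj.
    by exists m; split=> //; exists g; do 3!split=> //; left.
  by rewrite -ma cjE // => /(mem_inj Gm)/esym.
have [m [Gm m1 ma [g [Gg mg]]]] := H _ _ Dp Da pa.
exists (cj h (finv m)); split; first exact: mem_cj (mem_finv Gm).
  by exists m; split=> //; exists g; do 3!split=> //; right.
move=> /(cj_moves h p (mem_finv Gm)).
have -> : finv (finv m) p = m p.
  by apply: (mem_inj (mem_finv Gm)); rewrite finvK // finvKV //; exact: mem_finv.
by rewrite ma => /esym.
Qed.

(** If f moves x outside D, a conjugate of h moving x lives on a translate of D disjoint from D, so
    it is disjoint from all generators but not from f. Conversely, by [gen_cover], elements of [prp]
    fix D pointwise. *)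
Lemma pol_span f : f \inG -> (pol h f <-> forall x, f x <> x -> D x).
Proof.
have [Da Dha aha _] := sp; have [_ st cvx] := bD.
move=> Gf; split=> [Sf x fx|sub k Gk pk x].
  have [g [Gg gx]] := trG a x; apply: NNPP => nDx.
  case: (Sf (cj h g) (mem_cj Gh Gg) _ x) => // [f' Gf' gf' y|].
    case: (classic (f' y = y)) => [|/(gen_supp gf') Dy]; first by left.
    right; apply: NNPP => hy.
    have Dg : D (finv g y) by apply: supD => /(cj_moves h y Gg).
    by apply: nDx; rewrite -gx; apply: (st g Gg _ Dg); rewrite ?finvKV.
  by rewrite -gx cjE // => /(mem_inj Gg)/esym.
case: (classic (f x = x)) => [|/sub/gen_cover[e [Ge ge ex]]]; [by right | left].
by case: (pk e Ge ge x).
Qed.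

Lemma hull_span x : hull h x <-> D x.
Proof.
split=> [[f [Gf Sf fx]]|/gen_cover[f [Gf gf fx]]]; first by move/pol_span: Sf; exact.
by exists f; split=> //; apply/pol_span => // y; exact: gen_supp.
Qed.

End Cover.

(** * Definable relations between hulls *)

Definition hmap h g h' : Prop := forall e, e \inG -> forall e', e' \inG ->
  pol h e -> (forall x, e' x = cj e g x) -> pol h' e'.
Definition hsub h h' : Prop := forall e, e \inG -> pol h e -> pol h' e.
Definition apart h g : Prop := forall e, e \inG -> forall e', e' \inG ->
  pol h e -> pol h e' -> dj (cj e g) e'.
Definition perp h f : Prop := forall e, e \inG -> pol h e -> dj e f.
Definition blk h : Prop := pol h h /\ (~ (forall x, h x = x) /\
  ((forall g, g \inG -> hmap h g h \/ apart h g) /\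
   (forall k, k \inG -> forall m, m \inG ->
      lef id m -> lef m k -> hmap h k h -> hmap h m h))).
Definition below h' h : Prop := blk h' /\ (hsub h' h /\ ~ hsub h h').
(* For [tau h], the o-block [hull h] is in T: all the smaller blocks stabilised by
   h avoid the support of f, so that no smaller block contains x and h x. *)
Definition tau h : Prop := blk h /\ exists f, f \inG /\ (~ (forall x, f x = x) /\
  (pol h f /\ forall h', h' \inG -> below h' h -> hmap h' h h' -> perp h' f)).
Definition hle h h' : Prop := exists g, g \inG /\ hmap h g h'.
(* w induces the identity on pi(D), where D = hull h *)
Definition triv h w : Prop := forall f, f \inG -> pol h f ->
  dj w f \/ exists h', h' \inG /\ (below h' h /\ (hmap h' w h' /\ ~ perp h' f)).

Lemma hmapP h g h' : g \inG -> (hmap h g h' <-> forall x, hull h x -> hull h' (g x)).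
Proof.
move=> Gg; split=> [le x [f [Gf Sf fx]]|le e Ge e' Ge' Se e'E].
  exists (cj f g); split; first exact: mem_cj.
    exact: le Gf _ (mem_cj Gf Gg) Sf (fun=> erefl).
  by rewrite cjE // => /(mem_inj Gg).
apply/polP => // x; rewrite e'E => /(cj_moves e x Gg) ne.
by rewrite -(finvKV Gg x); apply: le; exists e.
Qed.

Lemma hsubP h h' : hsub h h' <-> forall x, hull h x -> hull h' x.
Proof.
split=> [le x [f [Gf /(le _ Gf) Sf fx]]|le e Ge Se]; first by exists f.
by apply/polP => // x ex; apply: le; exists e.
Qed.

Lemma perpP h f : perp h f <-> forall x, hull h x -> f x = x.
Proof.
split=> [pf x [e [Ge Se ex]]|pf e Ge Se x]; first by case: (pf e Ge Se x).
by case: (classic (e x = x)) => [|ex]; [left | right; apply: pf; exists e].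
Qed.

Lemma apartP h g : g \inG -> (apart h g <-> forall x, hull h x -> ~ hull h (g x)).
Proof.
move=> Gg; split=> [ap x [e [Ge Se ex]] [e' [Ge' Se' ex']]|ap e Ge e' Ge' Se Se' x].
  by case: (ap e Ge e' Ge' Se Se' (g x)) => //; rewrite cjE // => /(mem_inj Gg).
apply: NNPP => /not_or_and[/(cj_moves e x Gg) ex ex'].
by apply: (ap (finv g x)); [exists e | rewrite finvKV //; exists e'].
Qed.

Lemma blk_hull h x : blk h -> h \inG -> h x <> x -> hull h x.
Proof. by move=> [Sh _] Gh; exact: (proj1 (polP h Gh)). Qed.

(** For convexity, let x <= y <= z with x and z in the hull. Some k >= 1 takes x to z, hence
    stabilises the hull, and some m between 1 and k takes x to y; the last clause of [blk] applies
    to m. *)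
Lemma blkP h : h \inG -> (blk h <-> [/\ pol h h, ~ (forall x, h x = x) & block (hull h)]).
Proof.
move=> Gh; split=> [[Sh [h1 [dich cvx]]]|[Sh h1 [_ st cvx]]].
  have st g : g \inG -> forall x, hull h x -> hull h (g x) ->
      forall y, hull h y -> hull h (g y).
    move=> Gg x hx hgx; case: (dich g Gg) => [/(hmapP h h Gg)//|].
    by move=> /(apartP h Gg)/(_ x hx).
  split=> //; split=> //.
    have [x /= hx] := not_all_ex_not _ _ h1.
    by exists x; exact: (proj1 (polP h Gh)).
  move=> x y z xy yz hx hz.
  have [k [Gk k1 kx]] := push (le_trans xy yz); rewrite -kx in yz.
  have [m [Gm m1 mk <-]] := push_below Gk k1 xy yz.
  apply: (proj1 (hmapP h h Gm)) (hx); apply: (cvx k Gk m Gm m1 mk).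
  by apply/(hmapP h h Gk); apply: (st _ Gk x hx); rewrite kx.
split=> //; split=> //; split=> [g Gg|k Gk m Gm m1 mk].
  case: (classic (exists x, hull h x /\ hull h (g x))) => [[x [hx hgx]]|no].
    by left; apply/hmapP => //; exact: (st g Gg x).
  by right; apply/apartP => // x hx hgx; apply: no; exists x.
move=> /(hmapP h h Gk) le; apply/hmapP => // x hx.
by apply: (cvx x _ (k x)) => //; exact: le.
Qed.

Lemma blk_block h : h \inG -> blk h -> block (hull h).
Proof. by move=> Gh /(blkP Gh)[]. Qed.

Lemma stP D g : block D -> (st G D g <-> g \inG /\ forall x, D x -> D (g x)).
Proof.
move=> bD; have [[c Dc] _ _] := bD; split=> [[Gg e]|[Gg le]]; split=> //.
  by move=> x Dx; apply/e; exists x.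
move=> y; split=> [Dy|[x [Dx <-]]]; last exact: le.
exists (finv g y); rewrite finvKV //; split=> //.
by apply: (block_inv bD Gg Dc (le _ Dc)); rewrite finvKV.
Qed.

(** * Classes of spine members *)

Lemma in_T_class R c : in_spine G R -> in_T G (R c).
Proof. by move=> sR; exists R; split=> //; exists c. Qed.

Lemma spine_block R c : in_spine G R -> block (R c).
Proof. by move=> /spine_cc/(cc_class c). Qed.

Lemma spine_refl R c : in_spine G R -> R c c.
Proof. by move=> /spine_cc[]. Qed.

(** A generating pair of R is moved so that its first point is c, and swapped if it is
    decreasing. *)
Lemma spine_spans R c : in_spine G R -> exists a b, a < b /\ spans (R c) a b.
Proof.
move=> sR; have [Rr Rs Rt Ri _] := spine_cc sR.
have [a [b [ab RV]]] := sR; have [g [Gg ga]] := trG a c.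
have sp : spans (R c) c (g b).
  split=> //.
  - by rewrite -ga; apply: Ri => //; apply/RV; exact: Vc_ab.
  - by rewrite -ga => /(mem_inj Gg).
  move=> Y bY Yc Yb x Rx; apply/(blockrel_class _ bY Yc).
  have [_ _ _ Ei _] := blockrel_cc bY.
  move/RV: Rx; apply; first exact: blockrel_cc.
  rewrite -(finvK Gg a) -(finvK Gg b) ga; apply: Ei; first exact: mem_finv.
  exact/blockrel_class.
have [Rc Rgb ne min] := sp.
case: (ltgtP c (g b)) => [lt|lt|//]; first by exists c, (g b).
by exists (g b), c; split=> //; split=> //; [exact/nesym | move=> Y bY Yb Yc; exact: min].
Qed.

Definition smaller R' R : Prop :=
  (forall x y, R' x y -> R x y) /\ ~ (forall x y, R x y -> R' x y).

(** By transitivity one class determines the congruence. *)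
Lemma cc_sub_class E F c : convex_congruence G E -> convex_congruence G F ->
  (forall x, E c x -> F c x) -> forall x y, E x y -> F x y.
Proof.
move=> [_ _ _ Ei _] [_ _ _ Fi _] le x y Exy; have [g [Gg gx]] := trG x c.
rewrite -(finvK Gg x) -(finvK Gg y) gx; apply: Fi; first exact: mem_finv.
by apply: le; rewrite -gx; exact: Ei.
Qed.

Lemma not_sub_smaller R' R : convex_congruence G R' -> convex_congruence G R ->
  ~ (forall x y, R x y -> R' x y) -> smaller R' R.
Proof. by move=> c' c n; split=> //; case: (cc_total c' c). Qed.

(** * Spine classes as hulls of parameters *)

Context (abG : abundant G).

(** A positive element taking a to b stabilises the class, and abundance cuts it off outside. *)
Lemma gen_exists R c : in_spine G R ->
  exists h a, [/\ h \inG, lef id h, spans (R c) a (h a) & forall x, h x <> x -> R c x].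
Proof.
move=> sR; have [a [b [ab sp]]] := spine_spans c sR.
have bR := spine_block c sR.
have [Ra Rb _ _] := sp.
have [g [Gg g1 ga]] := push (ltW ab).
have [|h [Gh hE]] := abG (in_T_class c sR) (g := g).
  by apply/stP => //; split=> //; exact: stab_block ga.
have hon x : R c x -> h x = g x by move=> /(proj1 (hE x)).
have hoff x : ~ R c x -> h x = x by move=> /(proj2 (hE x)).
exists h, a; split=> //.
- by move=> x; case: (classic (R c x)) => [/hon|/hoff] -> //; exact: g1.
- by rewrite hon // ga.
by move=> x hx; apply: NNPP => /hoff.
Qed.

Lemma class_blk R c : in_spine G R -> exists h, [/\ h \inG, blk h &
  exists a, [/\ spans (R c) a (h a), (forall x, h x <> x -> R c x) &
  forall x, hull h x <-> R c x]].
Proof.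
move=> sR; have [h [a [Gh h1 sp sup]]] := gen_exists c sR.
have bR := spine_block c sR; have e := hull_span Gh h1 bR sp sup.
exists h; split=> //; last by exists a.
apply/blkP => //; split.
- by apply/(pol_span Gh h1 bR sp sup).
- by case: sp => _ _ aha _ /(_ a)/esym.
case: bR => [[x Rx] st cvx]; split; first by exists x; apply/e.
  by move=> g Gg y /e Ry /e Rgy z /e Rz; apply/e; exact: (st g Gg y).
by move=> x' y z xy yz /e Rx' /e Rz; apply/e; exact: (cvx x' y z).
Qed.

Lemma smaller_below R' R h c x : in_spine G R' -> in_spine G R -> smaller R' R ->
  (forall y, hull h y <-> R c y) -> R c x ->
  exists h', [/\ h' \inG, below h' h & forall y, hull h' y <-> R' x y].
Proof.
move=> sR' sR [le nle] hE Rx.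
have [_ Rs Rt _ _] := spine_cc sR.
have [h' [Gh' b' [a [_ _ e']]]] := class_blk x sR'.
exists h'; split=> //; split=> //; split.
  by apply/hsubP => y /e'/le Rxy; apply/hE; apply: (Rt _ x).
move=> /hsubP sub; apply: nle; apply: (cc_sub_class (c := x)); try exact: spine_cc.
by move=> y Rxy; apply/e'/sub/hE/(Rt _ x).
Qed.

(** It is not known that [hull h'] is a class of a spine member, so V(x, h' x) is taken for a point
    x moved by h'; the congruence of [hull h'] contains it. *)
Lemma below_smaller h' h R c : h' \inG -> in_spine G R -> below h' h ->
  (forall y, hull h y <-> R c y) -> exists R', in_spine G R' /\ smaller R' R.
Proof.
move=> Gh' sR [b' [/hsubP sub nsub]] hE.
have [_ Rs Rt _ _] := spine_cc sR.
have [Sh' h1 bl] := proj1 (blkP Gh') b'.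
have [x /= hx] := not_all_ex_not _ _ h1.
have Hx := blk_hull b' Gh' hx.
have Hhx : hull h' (h' x).
  by apply: (blk_hull b' Gh') => /(mem_inj Gh').
exists (Vc G x (h' x)); split; first by exists x, (h' x); split=> // e; apply: hx.
apply: not_sub_smaller; [exact: Vc_cc | exact: spine_cc | move=> RV].
apply: nsub; apply/hsubP => y /hE Ry.
have Rx : R c x by apply/hE/sub.
apply/(blockrel_class _ bl Hx).
apply: (RV x y); first by apply: (Rt _ c) => //; exact: Rs.
  exact: blockrel_cc.
exact/blockrel_class.
Qed.

(** If R is minimal, nothing lies below h and f = h works. Otherwise the hull of f is the class of a
    under a smaller R'. A block below h, stabilised by h and meeting the support of f, is comparable
    with that class, and the larger of the two contains a and h a, against [spans]. *)
Lemma tau_complete R c : in_spine G R ->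
  exists h, [/\ h \inG, tau h & forall x, hull h x <-> R c x].
Proof.
move=> sR; have [h [Gh bh [a [sp sup hE]]]] := class_blk c sR.
exists h; split=> //; split=> //.
have [Sh h1 bl] := proj1 (blkP Gh) bh; have [Ra Rha _ min] := sp.
case: (classic (exists R', in_spine G R' /\ smaller R' R)) => [[R' [sR' sm]]|no]; last first.
  exists h; do 3!split=> //.
  by move=> h' Gh' /below_smaller b'; case: no; exact: b' hE.
have [f [Gf bel hE']] := smaller_below sR' sR sm hE Ra.
have [bf [/hsubP subf _]] := bel.
have [Sf f1 blf] := proj1 (blkP Gf) bf.
exists f; split=> //; split=> //; split.
  by apply/polP => // x /(blk_hull bf Gf) /subf.
move=> h' Gh' [b' [sub nsub]] /(hmapP h' h' Gh) hh'; apply/perpP => x Hx.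
apply: NNPP => fx; have R'x := blk_hull bf Gf fx.
have [_ R's R't R'i _] := spine_cc sR'.
case: (block_total blf (blk_block Gh' b') R'x Hx) => le.
  apply: nsub; apply/hsubP => y /hE Ry; apply: min Ry; first exact: blk_block.
    by apply/le/hE'; exact: spine_refl.
  by apply/hh'/le/hE'; exact: spine_refl.
have [_ nle] := sm; apply: nle; apply: (cc_sub_class (c := a)); try exact: spine_cc.
have R'ah : R' a (h a).
  apply: (R't _ (h x)); first by apply/hE'/le/hh'.
  by apply: R's; apply: R'i => //; exact/hE'.
have [_ Rs Rt _ _] := spine_cc sR.
move=> y Ray; apply: (min (R' a)); [exact: spine_block| exact: spine_refl | by [] |].
exact: (Rt _ a).
Qed.

(** Let f move x. By [small], a spine class of x inside the hull that contains h x is the whole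
    hull. If h moves x, this applies to V(x, h x). If not, take V(z, h z) for some z moved by h: its
    class of x is comparable with the hull, and contains it in either case. *)
Lemma tau_sound h : h \inG -> tau h ->
  exists R, in_spine G R /\ forall x, hull h x -> forall y, hull h y <-> R x y.
Proof.
move=> Gh [bh [f [Gf [f1 [Sf small]]]]]; have [Sh h1 bl] := proj1 (blkP Gh) bh.
have [x /= fx] := not_all_ex_not _ _ f1.
have Hx : hull h x by exists f.
have key R : in_spine G R -> (forall y, R x y -> hull h y) -> R x (h x) ->
    forall y, hull h y -> R x y.
  move=> sR sub Rxhx; have [h' [Gh' bh' [_ [_ _ hE']]]] := class_blk x sR.
  apply: NNPP => nsub; apply: fx; apply: (proj1 (perpP h' f)); last first.
    by apply/hE'; exact: spine_refl.
  apply: small => //; last first.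
    apply/hmapP => // y /hE' Rxy; apply/hE'; have [_ st _] := spine_block x sR.
    by apply: (st h Gh x) => //; exact: spine_refl.
  split=> //; split; first by apply/hsubP => y /hE'/sub.
  by move=> /hsubP le; apply: nsub => y /le/hE'.
have full R z : in_spine G R -> hull h z -> (forall y, hull h y <-> R z y) ->
    forall x, hull h x -> forall y, hull h y <-> R x y.
  move=> sR Hz e x' Hx' y; have [_ Rs Rt _ _] := spine_cc sR.
  split=> [/e Rzy|Rxy]; first by apply: (Rt _ z) => //; exact/Rs/e.
  by apply/e; apply: (Rt _ x') => //; exact/e.
have V_sub z y : hull h z -> h z <> z -> Vc G z (h z) z y -> hull h y.
  move=> Hz hz V; apply/(blockrel_class _ bl Hz); apply: V; first exact: blockrel_cc.
  apply/blockrel_class => //; apply: (blk_hull bh Gh) => /(mem_inj Gh) //.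
have V_spine z : h z <> z -> in_spine G (Vc G z (h z)).
  by move=> hz; exists z, (h z); split=> // /esym.
case: (classic (h x = x)) => [hx|hx]; last first.
  exists (Vc G x (h x)); split; first exact: V_spine.
  apply: (full _ x (V_spine _ hx) Hx).
  move=> y; split; last exact: V_sub.
  by apply: key; [exact: V_spine | move=> ?; exact: V_sub | exact: Vc_ab].
have [z /= hz] := not_all_ex_not _ _ h1; have Hz := blk_hull bh Gh hz.
have sR := V_spine _ hz; set R := Vc G z (h z) in sR.
have [_ Rs Rt _ _] := spine_cc sR.
exists R; split=> //; apply: (full _ z) => // y; split; last exact: V_sub.
case: (block_total (spine_block x sR) bl (spine_refl x sR) Hx) => le.
  move=> Hy; apply: (Rt _ x); last first.
    by apply: key => //; rewrite hx; exact: spine_refl.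
  by apply: Rs; apply: key => //; rewrite hx; exact: spine_refl.
by move=> /le Rxy; apply: (Rt _ x) => //; apply: Rs; exact: le.
Qed.

(** * The spine member of a parameter *)

Definition kappa h : O -> O -> Prop := blockrel (hull h).

Lemma in_spine_same R S : same_rel R S -> in_spine G R -> in_spine G S.
Proof.
move=> RS [a [b [ab RV]]]; exists a, b; split=> // x y.
by split=> [/RS/RV|/RV/RS].
Qed.

Lemma kappa_same h R c : h \inG -> in_spine G R -> (forall x, hull h x <-> R c x) ->
  same_rel (kappa h) R.
Proof.
move=> Gh sR hE; have [_ Rs Rt Ri _] := spine_cc sR.
move=> x y; split=> [[g [Gg /hE Rx /hE Ry]]|Rxy].
  rewrite -(finvK Gg x) -(finvK Gg y); apply: Ri; first exact: mem_finv.
  by apply: (Rt _ c) => //; exact: Rs.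
have [g [Gg gx]] := trG x c; exists g; split=> //; apply/hE; first by rewrite gx; exact: spine_refl.
by rewrite -gx; exact: Ri.
Qed.

Lemma kappa_tau h : h \inG -> tau h -> in_spine G (kappa h) /\
  forall x, hull h x -> forall y, hull h y <-> kappa h x y.
Proof.
move=> Gh th; have [R [sR hE]] := tau_sound Gh th.
have bl := blk_block Gh (proj1 th); have [[c Hc] _ _] := bl.
have sm := kappa_same Gh sR (hE c Hc).
split; first by apply: in_spine_same sR => x y; split=> /sm.
by move=> x Hx y; split=> /(blockrel_class _ bl Hx).
Qed.

(** The classes of [kappa h] are the translates of [hull h], so one translate inside [hull h']
    decides the inclusion. *)
Lemma hle_kappa h h' : h \inG -> h' \inG -> tau h -> tau h' ->
  (hle h h' <-> forall x y, kappa h x y -> kappa h' x y).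
Proof.
move=> Gh Gh' th th'; split=> [[g [Gg /(hmapP h h' Gg) le]] x y [k [Gk Hx Hy]]|le].
  exists (mulf k g); split; [exact: mem_mulf | exact: le | exact: le].
have bl := blk_block Gh (proj1 th); have [[c Hc] _ _] := bl.
have bl' := blk_block Gh' (proj1 th'); have [[c' Hc'] _ _] := bl'.
have [g [Gg gc]] := trG c c'; exists g; split=> //; apply/hmapP => // y Hy.
apply/(blockrel_class _ bl' Hc'); rewrite -gc.
have [_ _ _ Ei _] := blockrel_cc bl'; apply: Ei => //; apply: le.
exact/blockrel_class.
Qed.

(* x and y lie in the same pi(R)-class ([piK_near]). *)
Definition near R : O -> O -> Prop := fun x y =>
  exists E, [/\ convex_congruence G E, ~ (forall x y, R x y -> E x y) & E x y].

(** A convex congruence relating a and b contains V(a,b), so those separating a and b are the ones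
    that do not contain R. *)
Lemma piK_near R x y : in_spine G R -> (piK G R x y <-> near R x y).
Proof.
move=> [a [b [ab RV]]]; split.
  move=> [c [d [cd RV' [E [cE [nE Exy]]]]]]; exists E; split=> // le; apply: nE.
  by apply/le/RV'; exact: Vc_ab.
move=> [E [cE nE Exy]]; exists a, b; split=> //; exists E; split=> //; split=> // Eab.
by apply: nE => u v /RV; exact.
Qed.

Lemma eq_cc : convex_congruence G (fun x y => x = y).
Proof.
split=> //; [by move=> x y z -> | by move=> g _ x y -> |].
by move=> x y z xy yz xz; apply/eqP; rewrite eq_le xy xz.
Qed.

Lemma near_refl R x : in_spine G R -> near R x x.
Proof.
move=> [a [b [ab RV]]]; exists (fun x y => x = y); split=> //; first exact: eq_cc.
by move=> le; apply/ab/le/RV; exact: Vc_ab.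
Qed.

Lemma near_sym R x y : near R x y -> near R y x.
Proof. by move=> [E [cE nE Exy]]; exists E; split=> //; case: cE => _ Es _ _ _; exact: Es. Qed.

Lemma near_trans R x y z : near R x y -> near R y z -> near R x z.
Proof.
move=> [E [cE nE Exy]] [F [cF nF Fyz]].
case: (cc_total cE cF) => le; [exists F | exists E]; split=> //.
  by case: cF => _ _ Ft _ _; apply: (Ft _ y) => //; exact: le.
by case: cE => _ _ Et _ _; apply: (Et _ y) => //; exact: le.
Qed.

Lemma near_sub R x y : in_spine G R -> near R x y -> R x y.
Proof.
by move=> /spine_cc cR [E [cE nE Exy]]; case: (cc_total cE cR) => le; [exact: le | case: nE].
Qed.

(** If w preserves the pi(R)-classes and both w and f move x, the V(x, w x)-class of x is stabilised
    by w and lies below h. Conversely, f is chosen to move x with support in a smaller spine class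
    of x; the block given by [triv] meets this support, and the larger of the two congruences
    relates x to w x. *)
Lemma trivP R h c w : in_spine G R -> (forall x, hull h x <-> R c x) -> h \inG -> w \inG ->
  (triv h w <-> forall x, R c x -> near R x (w x)).
Proof.
move=> sR hE Gh Gw; split=> [tr x Rx|nr f Gf Sf]; last first.
  case: (classic (dj w f)) => [|/not_all_ex_not[x /not_or_and[wx fx]]]; [by left|right].
  have Rx : R c x by apply/hE; exact: (proj1 (polP h Gf)).
  have [E [cE nE Exw]] := nr x Rx.
  have sV : in_spine G (Vc G x (w x)) by exists x, (w x); split=> // /esym.
  have VE u v : Vc G x (w x) u v -> E u v by apply.
  have sm : smaller (Vc G x (w x)) R.
    apply: not_sub_smaller; try exact: spine_cc.
    by move=> le; apply: nE => u v /le/VE.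
  have [h' [Gh' b' hE']] := smaller_below sV sR sm hE Rx.
  exists h'; split=> //; split=> //; split.
    apply/hmapP => // y /hE' Vy; apply/hE'; have [_ st _] := spine_block x sV.
    by apply: (st w Gw x) => //; exact: spine_refl.
  by move=> /perpP/(_ x) e; apply: fx; apply: e; apply/hE'; exact: spine_refl.
case: (classic (w x = x)) => [->|wx]; first exact: near_refl.
case: (classic (exists R', in_spine G R' /\ smaller R' R)) => [[R' [sR' sm]]|no]; last first.
  have [f [Gf Sf fx]] : hull h x by apply/hE.
  case: (tr f Gf Sf) => [/(_ x)[]//|[h' [Gh' [b' _]]]].
  by case: no; exact: (below_smaller Gh' sR b' hE).
have [h1 [Gh1 b1 hE1]] := smaller_below sR' sR sm hE Rx.
have [f [Gf Sf fx]] : hull h1 x by apply/hE1; exact: spine_refl.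
case: (tr f Gf); first by apply b1.2.1.
  by move=> /(_ x)[].
move=> [h' [Gh' [b' [/(hmapP h' h' Gw) hw nperp]]]].
have [y [Hy fy]] : exists y, hull h' y /\ f y <> y.
  apply: NNPP => n; apply: nperp; apply/perpP => y Hy.
  by apply: NNPP => fy; apply: n; exists y.
have R'y : R' x y by apply/hE1; exact: (proj1 (polP h1 Gf)).
have bl := blk_block Gh' (proj1 b'); have cE := blockrel_cc bl.
have nE : ~ (forall x y, R x y -> blockrel (hull h') x y).
  move=> le; have [_ [/hsubP sub nsub]] := b'; apply: nsub; apply/hsubP => z /hE Rz.
  apply/(blockrel_class _ bl Hy)/le.
  have [_ Rs Rt _ _] := spine_cc sR; apply: (Rt _ c) => //; apply: Rs.
  exact/hE/sub.
(* Invariance turns E x y into E (w x) (w y), which closes the chain x, y, w y, w x. *)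
have step E : convex_congruence G E -> ~ (forall x y, R x y -> E x y) ->
    E x y -> E y (w y) -> near R x (w x).
  move=> cE' nE' Exy Eyw; have [_ Es Et Ei _] := cE'; exists E; split=> //.
  by apply: (Et _ y) => //; apply: (Et _ (w y)) => //; apply: Ei => //; exact: Es.
have Eyw : blockrel (hull h') y (w y) by apply/blockrel_class => //; exact: hw.
case: (cc_total cE (spine_cc sR')) => le.
  by apply: (step R') => //; [exact: spine_cc | exact: sm.2 | exact: le].
by apply: (step _ cE nE) => //; exact: le.
Qed.

(** Equality in the component becomes triviality of a quotient, which [trivP] makes definable. *)
Lemma component_eqP R c u v : in_spine G R -> st G (R c) u -> st G (R c) v ->
  (@ls_eq (component G R c) u v <-> forall x, R c x -> near R x (mulf u (finv v) x)).
Proof.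
move=> sR; have bR := spine_block c sR.
move=> /(stP _ bR)[Gu Ru] /(stP _ bR)[Gv Rv].
have [_ Rs Rt _ _] := spine_cc sR.
have nR x z : R c x -> near R x z -> R c z.
  by move=> Rx /(near_sub sR); exact: (Rt).
rewrite /mulf /=; split=> [e x Rx|e x Rx y].
  have [|z [/(piK_near _ _ sR) xz vz]] := proj1 (e x Rx (u x)).
    by exists x; split=> //; apply/piK_near => //; exact: near_refl.
  by rewrite -vz finvK.
split=> [[z [/(piK_near _ _ sR) xz <-]]|[z [/(piK_near _ _ sR) xz <-]]].
  exists (finv v (u z)); rewrite finvKV //; split=> //; apply/piK_near => //.
  by apply: (near_trans xz); apply: e; exact: nR xz.
exists (finv u (v z)); rewrite finvKV //; split=> //; apply/piK_near => //.
have Ru' : R c (finv u (v z)).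
  have [[d Rd] _ _] := bR; apply: (block_inv bR Gu Rd (Ru _ Rd)); rewrite finvKV //.
  exact: Rv (nR _ _ Rx xz).
apply: (near_trans xz); apply: near_sym.
by have := e _ Ru'; rewrite finvKV // finvK.
Qed.

End Perm.

(** * Formulas *)

Local Coercion TVar : nat >-> lterm.

Definition fle s t : lform := LEq (TJoin s t) t.
Definition fdj s t : lform :=
  LEq (TMeet (TJoin s (TInv s)) (TJoin t (TInv t))) TOne.
Definition tcj s t : lterm := TMul (TMul (TInv t) s) t.

(* The last argument n of these formulas must exceed all their free variables;
   bound variables are numbered from n on. *)
Definition fgen (h f n : nat) : lform :=
  LEx n (LEx n.+1 (LAnd (fle TOne n)
    (LAnd (LOr (fle n (tcj h n.+1)) (LAnd (fle n n.+1) (LNot (fdj (tcj h n.+1) h))))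
          (LOr (LEq f (tcj h n)) (LEq f (tcj h (TInv n))))))).
Definition fprp (h k n : nat) : lform := LAll n (LImp (fgen h n n.+1) (fdj n k)).
Definition fpol (h f n : nat) : lform := LAll n (LImp (fprp h n n.+1) (fdj n f)).
(** The conjugate is bound to variable n.+1 because [fpol] accepts variables, not terms. *)
Definition fhmap (h g h' n : nat) : lform :=
  LAll n (LAll n.+1 (LImp (fpol h n n.+2)
    (LImp (LEq n.+1 (tcj n g)) (fpol h' n.+1 n.+2)))).
Definition fhsub (h h' n : nat) : lform :=
  LAll n (LImp (fpol h n n.+1) (fpol h' n n.+1)).
Definition fapart (h g n : nat) : lform :=
  LAll n (LAll n.+1 (LImp (fpol h n n.+2)
    (LImp (fpol h n.+1 n.+2) (fdj (tcj n g) n.+1)))).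
Definition fperp (h f n : nat) : lform := LAll n (LImp (fpol h n n.+1) (fdj n f)).
Definition fblk (h n : nat) : lform :=
  LAnd (fpol h h n) (LAnd (LNot (LEq h TOne))
    (LAnd (LAll n (LOr (fhmap h n h n.+1) (fapart h n n.+1)))
          (LAll n (LAll n.+1 (LImp (fle TOne n.+1) (LImp (fle n.+1 n)
             (LImp (fhmap h n h n.+2) (fhmap h n.+1 h n.+2)))))))).
Definition fbelow (h' h n : nat) : lform :=
  LAnd (fblk h' n) (LAnd (fhsub h' h n) (LNot (fhsub h h' n))).
Definition ftau (h n : nat) : lform :=
  LAnd (fblk h n) (LEx n (LAnd (LNot (LEq n TOne)) (LAnd (fpol h n n.+1)
    (LAll n.+1 (LImp (fbelow n.+1 h n.+2)
       (LImp (fhmap n.+1 h n.+1 n.+2) (fperp n.+1 n n.+2))))))).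
Definition fhle (h h' n : nat) : lform := LEx n (fhmap h n h' n.+1).
Definition ftriv (h w n : nat) : lform :=
  LAll n (LImp (fpol h n n.+1) (LOr (fdj w n) (LEx n.+1 (LAnd (fbelow n.+1 h n.+2)
    (LAnd (fhmap n.+1 w n.+1 n.+2) (LNot (fperp n.+1 n n.+2))))))).

(** * Environments and satisfaction *)

Lemma updE (A : Type) (env : nat -> A) n a : upd env n a n = a.
Proof. by rewrite /upd eqxx. Qed.

Lemma updN (A : Type) (env : nat -> A) n a k : (k != n) -> upd env n a k = env k.
Proof. by rewrite /upd => /negPf->. Qed.

Lemma upd_lt (A : Type) (env : nat -> A) n a k : (k < n)%N -> upd env n a k = env k.
Proof. by move=> kn; rewrite updN // ltn_eqF. Qed.

Lemma upd_P (A : Type) (P : A -> Prop) (env : nat -> A) n a :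
  (forall k, P (env k)) -> P a -> forall k, P (upd env n a k).
Proof. by move=> Pe Pa k; rewrite /upd; case: eqP. Qed.

Section Sat.
Context (M : lstruct).
Implicit Types (env : nat -> ls_car M) (p q : lform) (A B : Prop).

Lemma sat_all env n p (P : ls_car M -> Prop) :
  (forall a, ls_dom a -> (lsat (upd env n a) p <-> P a)) ->
  (lsat env (LAll n p) <-> forall a, ls_dom a -> P a).
Proof. by move=> e; split=> /= H a Da; apply/e => //; exact: H. Qed.

Lemma sat_ex env n p (P : ls_car M -> Prop) :
  (forall a, ls_dom a -> (lsat (upd env n a) p <-> P a)) ->
  (lsat env (LEx n p) <-> exists a, ls_dom a /\ P a).
Proof. by move=> e; split=> /= -[a [Da H]]; exists a; split=> //; apply/e. Qed.

Lemma sat_and env p q A B : (lsat env p <-> A) -> (lsat env q <-> B) ->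
  (lsat env (LAnd p q) <-> A /\ B).
Proof. by move=> /= -> ->. Qed.
Lemma sat_or env p q A B : (lsat env p <-> A) -> (lsat env q <-> B) ->
  (lsat env (LOr p q) <-> A \/ B).
Proof. by move=> /= -> ->. Qed.
Lemma sat_imp env p q A B : (lsat env p <-> A) -> (lsat env q <-> B) ->
  (lsat env (LImp p q) <-> (A -> B)).
Proof. by move=> /= -> ->. Qed.
Lemma sat_not env p A : (lsat env p <-> A) -> (lsat env (LNot p) <-> ~ A).
Proof. by move=> /= ->. Qed.

Lemma leval_agree env env' t :
  (forall n, tfree n t -> env n = env' n) -> leval env t = leval env' t.
Proof.
elim: t => [n|//|a IHa b IHb|a IHa|a IHa b IHb|a IHa b IHb] /= e; first exact: e.
all: rewrite ?IHa ?IHb // => n nt; apply: e => //; by rewrite nt ?orbT.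
Qed.

Lemma lsat_agree p env env' : (forall n, lfree n p -> env n = env' n) ->
  (lsat env p <-> lsat env' p).
Proof.
have up q env1 env2 m a : (forall n, (m != n) && lfree n q -> env1 n = env2 n) ->
    forall n, lfree n q -> upd env1 m a n = upd env2 m a n :> ls_car M.
  move=> e n nq; rewrite /upd; case: eqP => // nm; apply: e.
  by rewrite nq andbT; apply/eqP => mn; apply: nm.
elim: p env env' => [s t|//|q IH|q IHq r IHr|q IHq r IHr|q IHq r IHr|m q IH|m q IH] env env' /= e.
- by rewrite (@leval_agree env env' s) ?(@leval_agree env env' t) // => n nt;
    apply: e; rewrite nt ?orbT.
- by rewrite (IH env env').
- by rewrite (IHq env env') ?(IHr env env') // => n nt; apply: e; rewrite nt ?orbT.
- by rewrite (IHq env env') ?(IHr env env') // => n nt; apply: e; rewrite nt ?orbT.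
- by rewrite (IHq env env') ?(IHr env env') // => n nt; apply: e; rewrite nt ?orbT.
- by split=> H a Da; apply/(IH _ _ (up q _ _ m a e)); exact: H.
- by split=> -[a [Da H]]; exists a; split=> //; apply/(IH _ _ (up q _ _ m a e)).
Qed.

Lemma lmodels_sentence p env : lsentence p -> (forall n, ls_dom (env n)) ->
  (lmodels M p <-> lsat env p).
Proof.
move=> sp De; split=> [|H env' _]; first exact.
by apply/(@lsat_agree p env env') => // n; rewrite sp.
Qed.

Lemma lmodels_all n p : lmodels M (LAll n p) <-> lmodels M p.
Proof.
split=> H env De; last by move=> a Da; apply: H; exact: upd_P.
have := H env De (env n) (De n).
suff -> : upd env n (env n) = env by [].
by apply: functional_extensionality => k; rewrite /upd; case: eqP => [->|].
Qed.

End Sat.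

(** * Universal closure *)

Lemma tfree_bound t : exists N, forall n, (N <= n)%N -> tfree n t = false.
Proof.
elim: t => [m||a [N IHa] b [N' IHb]|a [N IHa]|a [N IHa] b [N' IHb]|a [N IHa] b [N' IHb]] /=.
- by exists m.+1 => n mn; apply/eqP; lia.
- by exists 0.
- by exists (maxn N N') => n; rewrite geq_max => /andP[/IHa-> /IHb->].
- by exists N.
- by exists (maxn N N') => n; rewrite geq_max => /andP[/IHa-> /IHb->].
- by exists (maxn N N') => n; rewrite geq_max => /andP[/IHa-> /IHb->].
Qed.

Lemma lfree_bound p : exists N, forall n, (N <= n)%N -> lfree n p = false.
Proof.
elim: p => [s t||q [N IH]|q [N IHq] r [N' IHr]|q [N IHq] r [N' IHr]
  |q [N IHq] r [N' IHr]|m q [N IH]|m q [N IH]] /=.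
- have [[N IHs] [N' IHt]] := (tfree_bound s, tfree_bound t).
  by exists (maxn N N') => n; rewrite geq_max => /andP[/IHs-> /IHt->].
- by exists 0.
- by exists N.
- by exists (maxn N N') => n; rewrite geq_max => /andP[/IHq-> /IHr->].
- by exists (maxn N N') => n; rewrite geq_max => /andP[/IHq-> /IHr->].
- by exists (maxn N N') => n; rewrite geq_max => /andP[/IHq-> /IHr->].
- by exists N => n /IH->; rewrite andbF.
- by exists N => n /IH->; rewrite andbF.
Qed.

(** Elementary equivalence speaks of sentences only, so p is closed over the variables below B; by
    [lmodels_all] this does not affect validity. *)
Lemma lequiv_formula M N p : lequiv M N -> (lmodels M p <-> lmodels N p).
Proof.
move=> MN; have [B bound] := lfree_bound p.
have cl K : lmodels K (foldr LAll p (iota 0 B)) <-> lmodels K p.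
  by elim: (iota 0 B) => //= n s IH; rewrite lmodels_all.
rewrite -(cl M) -(cl N); apply: MN => n.
have /= free s : lfree n (foldr LAll p s) = (n \notin s) && lfree n p.
  by elim: s => //= m s ->; rewrite inE negb_or andbA eq_sym.
rewrite free mem_iota add0n /= -leqNgt.
by case: leqP => //= /bound.
Qed.

(** * Correctness of the formulas *)

Section Interp.
Context {disp : Order.disp_t} {O : orderType disp} (G : lperm O).
Implicit Types (env : nat -> O -> O) (n h f g k : nat).
Local Notation "f \inG" := (lp_mem G f) (at level 70).
Local Notation lsatG := (@lsat (lgroup G)).
Local Notation levalG := (@leval (lgroup G)).

Lemma leval_mem env t : (forall n, env n \inG) -> levalG env t \inG.
Proof.
move=> Ge; elim: t => [n||a IHa b IHb|a IHa|a IHa b IHb|a IHa b IHb] /=.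
- exact: Ge.
- exact: lp_id.
- exact: mem_mulf.
- exact: mem_finv.
- exact: mem_joinf.
- exact: mem_meetf.
Qed.

Lemma fleP env s t : lsatG env (fle s t) <-> lef (levalG env s) (levalG env t).
Proof.
by split=> H x; [apply/max_idPr; exact: (H x) | apply/max_idPr; exact: (H x)].
Qed.

(** The absolute value of f sends x strictly above x when f moves x and fixes x otherwise; in a
    chain the minimum of two such values is x only if one of them is. *)
Lemma fdjP env s t : (forall n, env n \inG) ->
  (lsatG env (fdj s t) <-> dj (levalG env s) (levalG env t)).
Proof.
move=> Ge; have Gs := leval_mem s Ge; have Gt := leval_mem t Ge.
have abs (f : O -> O) x : f \inG -> f x <> x -> x < Order.max (f x) (finv f x).
  move=> Gf fx; rewrite lt_max; case: (ltgtP x (f x)) => [//|lt|/esym//].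
  by rewrite -(mono_lt _ _ Gf) (finvKV Gf) lt.
have abs1 (f : O -> O) x : f \inG -> x <= Order.max (f x) (finv f x).
  move=> Gf; case: (classic (f x = x)) => [e|/(abs _ _ Gf)/ltW//].
  by rewrite le_max e lexx.
have abs0 (f : O -> O) x : f \inG -> f x = x -> Order.max (f x) (finv f x) = x.
  by move=> Gf fx; rewrite (finv_fix Gf fx) fx maxxx.
rewrite /=; split=> H x.
  apply: NNPP => /not_or_and[/(abs _ _ Gs) sx /(abs _ _ Gt) tx].
  by have := H x; rewrite /meetf /joinf => e; move: (conj sx tx) => /andP; rewrite -lt_min e ltxx.
by rewrite /meetf /joinf; case: (H x) => [/(abs0 _ _ Gs)|/(abs0 _ _ Gt)] ->;
  [apply: min_l | apply: min_r]; exact: abs1.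
Qed.

(** [cong] descends through the connectives, [leaf] closes a subformula by the lemma interpreting
    it, and [upds] and [mem] handle updated environments. *)
Ltac upds := repeat (rewrite updE || (rewrite upd_lt; [|lia])).
Ltac mem := by repeat (apply: upd_P => //).
Ltac cong := repeat match goal with
  | |- lsat _ (LAll _ _) <-> _ => apply: sat_all => ? ?
  | |- lsat _ (LEx _ _) <-> _ => apply: sat_ex => ? ?
  | |- lsat _ (LAnd _ _) <-> _ => apply: sat_and
  | |- lsat _ (LOr _ _) <-> _ => apply: sat_or
  | |- lsat _ (LImp _ _) <-> _ => apply: sat_imp
  | |- lsat _ (LNot _) <-> _ => apply: sat_not
  end.
Ltac leaf L :=
  (eapply iff_trans; [apply L; by [lia | mem] | rewrite /=; upds; exact: iff_refl]).

Lemma fgenP env h f n : (forall k, env k \inG) -> (h < n)%N -> (f < n)%N ->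
  (lsatG env (fgen h f n) <-> gen G (env h) (env f)).
Proof.
move=> Ge hn fn; rewrite /fgen /gen; cong;
  try leaf fdjP; try leaf fleP; rewrite /=; upds; exact: iff_refl.
Qed.

Lemma fprpP env h k n : (forall k, env k \inG) -> (h < n)%N -> (k < n)%N ->
  (lsatG env (fprp h k n) <-> prp G (env h) (env k)).
Proof. by move=> Ge hn kn; rewrite /fprp /prp; cong; [leaf fgenP | leaf fdjP]. Qed.

Lemma fpolP env h f n : (forall k, env k \inG) -> (h < n)%N -> (f < n)%N ->
  (lsatG env (fpol h f n) <-> pol G (env h) (env f)).
Proof. by move=> Ge hn fn; rewrite /fpol /pol; cong; [leaf fprpP | leaf fdjP]. Qed.

Lemma fhmapP env h g h' n : (forall k, env k \inG) ->
  (h < n)%N -> (g < n)%N -> (h' < n)%N ->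
  (lsatG env (fhmap h g h' n) <-> hmap G (env h) (env g) (env h')).
Proof.
move=> Ge hn gn hn'; rewrite /fhmap /hmap; cong; try leaf fpolP.
by rewrite /=; upds; exact: iff_refl.
Qed.

Lemma fhsubP env h h' n : (forall k, env k \inG) -> (h < n)%N -> (h' < n)%N ->
  (lsatG env (fhsub h h' n) <-> hsub G (env h) (env h')).
Proof. by move=> Ge hn hn'; rewrite /fhsub /hsub; cong; leaf fpolP. Qed.

Lemma fapartP env h g n : (forall k, env k \inG) -> (h < n)%N -> (g < n)%N ->
  (lsatG env (fapart h g n) <-> apart G (env h) (env g)).
Proof.
by move=> Ge hn gn; rewrite /fapart /apart; cong; (leaf fpolP || leaf fdjP).
Qed.

Lemma fperpP env h f n : (forall k, env k \inG) -> (h < n)%N -> (f < n)%N ->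
  (lsatG env (fperp h f n) <-> perp G (env h) (env f)).
Proof. by move=> Ge hn fn; rewrite /fperp /perp; cong; (leaf fpolP || leaf fdjP). Qed.

Lemma fblkP env h n : (forall k, env k \inG) -> (h < n)%N ->
  (lsatG env (fblk h n) <-> blk G (env h)).
Proof.
move=> Ge hn; rewrite /fblk /blk; cong;
  try (leaf fpolP || leaf fhmapP || leaf fapartP || leaf fleP).
by rewrite /=; upds; exact: iff_refl.
Qed.

Lemma fbelowP env h h' n : (forall k, env k \inG) -> (h < n)%N -> (h' < n)%N ->
  (lsatG env (fbelow h h' n) <-> below G (env h) (env h')).
Proof.
by move=> Ge hn hn'; rewrite /fbelow /below; cong; (leaf fblkP || leaf fhsubP).
Qed.

Lemma ftauP env h n : (forall k, env k \inG) -> (h < n)%N ->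
  (lsatG env (ftau h n) <-> tau G (env h)).
Proof.
move=> Ge hn; rewrite /ftau /tau; cong;
  try (leaf fblkP || leaf fpolP || leaf fhmapP || leaf fbelowP || leaf fperpP).
by rewrite /=; upds; exact: iff_refl.
Qed.

Lemma fhleP env h h' n : (forall k, env k \inG) -> (h < n)%N -> (h' < n)%N ->
  (lsatG env (fhle h h' n) <-> hle G (env h) (env h')).
Proof. by move=> Ge hn hn'; rewrite /fhle /hle; cong; leaf fhmapP. Qed.

Lemma ftrivP env h f n : (forall k, env k \inG) -> (h < n)%N -> (f < n)%N ->
  (lsatG env (ftriv h f n) <-> triv G (env h) (env f)).
Proof.
by move=> Ge hn fn; rewrite /ftriv /triv; cong;
  (leaf fdjP || leaf fpolP || leaf fhmapP || leaf fbelowP || leaf fperpP).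
Qed.

End Interp.

(** * Translation of formulas about components and the spine *)

Fixpoint shift_term (s : nat) (t : lterm) : lterm :=
  match t with
  | TVar n => TVar (n + s)
  | TOne => TOne
  | TMul a b => TMul (shift_term s a) (shift_term s b)
  | TInv a => TInv (shift_term s a)
  | TJoin a b => TJoin (shift_term s a) (shift_term s b)
  | TMeet a b => TMeet (shift_term s a) (shift_term s b)
  end.

(* Relativises a formula to the component on [hull h] for h the value of
   variable q; variable n becomes n + q + 2 and q + 1 holds quotients. *)
Fixpoint component_form (q : nat) (p : lform) : lform :=
  match p with
  | LEq s t => LEx q.+1 (LAnd
      (LEq q.+1 (TMul (shift_term q.+2 s) (TInv (shift_term q.+2 t))))
      (ftriv q q.+1 q.+2))
  | LBot => LBot
  | LNot p => LNot (component_form q p)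
  | LAnd p r => LAnd (component_form q p) (component_form q r)
  | LOr p r => LOr (component_form q p) (component_form q r)
  | LImp p r => LImp (component_form q p) (component_form q r)
  | LAll m p => LAll (m + q.+2)
      (LImp (fhmap q (m + q.+2) q (m + q.+3)) (component_form q p))
  | LEx m p => LEx (m + q.+2)
      (LAnd (fhmap q (m + q.+2) q (m + q.+3)) (component_form q p))
  end.

(** Different parameters may represent one spine member, so equality becomes [fhle] in both
    directions. *)
Fixpoint spine_form (I : Type) (col : I -> nat -> lform) (p : cform I) : lform :=
  match p with
  | CLe a b => fhle a b (maxn a b).+1
  | CEq a b => LAnd (fhle a b (maxn a b).+1) (fhle b a (maxn a b).+1)
  | CP i a => col i a
  | CBot => LBot
  | CNot p => LNot (spine_form col p)
  | CAnd p r => LAnd (spine_form col p) (spine_form col r)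
  | COr p r => LOr (spine_form col p) (spine_form col r)
  | CImp p r => LImp (spine_form col p) (spine_form col r)
  | CAll m p => LAll m (LImp (ftau m m.+1) (spine_form col p))
  | CEx m p => LEx m (LAnd (ftau m m.+1) (spine_form col p))
  end.

(** A colour is a condition on all classes of a spine member, hence the quantifier over all
    parameters representing it. *)
Definition colour_form (s : lsent) (n : nat) : lform :=
  LAll n.+1 (LImp
    (LAnd (ftau n.+1 n.+2) (LAnd (fhle n n.+1 n.+2) (fhle n.+1 n n.+2)))
    (component_form n.+1 (proj1_sig s))).

Definition irreducible_form : lform :=
  LEx 0 (LAnd (LAnd (LEq (TJoin TOne 0) 0) (LNot (LEq 0 TOne)))
    (LAll 1 (LAll 2 (LImp (LEq (TJoin 1 2) 0)
      (LImp (LEq (TMeet 1 2) TOne) (LOr (LEq 1 TOne) (LEq 2 TOne))))))).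

Lemma irreducible_sentence : lsentence irreducible_form.
Proof. by do 3?[case=> //]. Qed.

Lemma irreducible_formP M (env : nat -> ls_car M) : lsat env irreducible_form <->
  exists g, ls_dom g /\ @irreducible M g.
Proof.
split=> -[g [Dg [ge irr]]]; exists g; split=> //; split=> // g1.
  by move=> g2 D1 D2; exact: (irr g1 D1 g2 D2).
by move=> D1 g2 D2; exact: (irr g1 g2 D1 D2).
Qed.

(** * Translation of sentences *)

Section Transfer.
Context {disp : Order.disp_t} {O : orderType disp} (G : lperm O).
Context (trG : ltransitive G) (abG : abundant G).
Implicit Types (env : nat -> O -> O).
Local Notation "f \inG" := (lp_mem G f) (at level 70).
Local Notation lsatG := (@lsat (lgroup G)).
Local Notation levalG := (@leval (lgroup G)).

(** * Interpretation of the components *)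

Section Component.
Context (R : O -> O -> Prop) (c : O) (h : O -> O).
Context (sR : in_spine G R) (Gh : h \inG) (hE : forall x, hull G h x <-> R c x).
Local Notation C := (component G R c).

Lemma st_hmap g : st G (R c) g <-> g \inG /\ hmap G h g h.
Proof.
have bR := spine_block c sR.
split=> [/(stP _ bR)[Gg le]|[Gg /hmapP le]].
  by split=> //; apply/hmapP => // x /hE/le/hE.
by apply/stP => //; split=> // x /hE/(le Gg)/hE.
Qed.

Lemma leval_shift env (cenv : nat -> ls_car C) s t :
  (forall n, tfree n t -> env (n + s) = cenv n) ->
  levalG env (shift_term s t) = leval cenv t :> (O -> O).
Proof.
elim: t => [n|//|a IHa b IHb|a IHa|a IHa b IHb|a IHa b IHb] /= e;
  first by apply: e.
all: rewrite ?IHa ?IHb // => n nt; apply: e => //; by rewrite nt ?orbT.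
Qed.

Lemma leval_st (cenv : nat -> ls_car C) t :
  (forall n, tfree n t -> st G (R c) (cenv n)) -> st G (R c) (leval cenv t).
Proof.
have bR := spine_block c sR; have [[d Rd] _ _] := bR.
have stE := stP _ bR.
elim: t => [n||a IHa b IHb|a IHa|a IHa b IHb|a IHa b IHb] /= e.
- exact: e.
- by apply/stE; split=> //; exact: lp_id.
all: have /stE[Ga ra] : st G (R c) (leval cenv a)
       by apply: IHa => n nt; apply: e; rewrite nt.
2: { apply/stE; split=> [|x Rx]; first exact: mem_finv.
     by apply: (block_inv bR Ga Rd (ra _ Rd)); rewrite (finvKV Ga). }
all: have /stE[Gb rb] : st G (R c) (leval cenv b)
       by apply: IHb => n nt; apply: e; rewrite nt orbT.
- by apply/stE; split=> [|x /ra/rb//]; exact: mem_mulf.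
- apply/stE; split=> [|x Rx]; first exact: mem_joinf.
  by rewrite /joinf; case: leP => _; [exact: rb | exact: ra].
apply/stE; split=> [|x Rx]; first exact: mem_meetf.
by rewrite /meetf; case: leP => _; [exact: ra | exact: rb].
Qed.

(** Agreement is required at free variables only, as the other values of [env] are arbitrary
    elements of G. *)
Lemma component_formP q p env (cenv : nat -> ls_car C) :
  (forall n, env n \inG) -> env q = h ->
  (forall n, lfree n p -> st G (R c) (cenv n) /\ env (n + q.+2) = cenv n) ->
  (lsat cenv p <-> lsatG env (component_form q p)).
Proof.
have up r env1 (cenv1 : nat -> ls_car C) m a : st G (R c) a ->
    (forall n, (m != n) && lfree n r ->
      st G (R c) (cenv1 n) /\ env1 (n + q.+2) = cenv1 n) ->
    forall n, lfree n r -> st G (R c) (upd cenv1 m a n) /\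
      upd env1 (m + q.+2) a (n + q.+2) = upd cenv1 m a n.
  move=> sa e n nr; rewrite /upd eqn_add2r; case: eqP => // nm; apply: e.
  by rewrite nr andbT; apply/eqP => mn; apply: nm.
have bind env1 m a : (forall n, env1 n \inG) -> env1 q = h -> a \inG ->
    (lsatG (upd env1 (m + q.+2) a) (fhmap q (m + q.+2) q (m + q.+3)) <-> hmap G h a h).
  move=> Ge eq Ga; apply: iff_trans (fhmapP _ _ _ _) _; try lia; first exact: upd_P.
  by rewrite updE upd_lt ?eq //; lia.
elim: p env cenv => [s t|//|r IH|r IHr u IHu|r IHr u IHu|r IHr u IHu|m r IH|m r IH]
  env cenv Ge eq e.
- have [ss st_] : st G (R c) (leval cenv s) /\ st G (R c) (leval cenv t).
    by split; apply: leval_st => n nt; apply: (proj1 (e n _)); rewrite /= nt ?orbT.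
  apply: iff_trans (component_eqP trG sR ss st_) _.
  have /(st_hmap)[Gs _] := ss; have /(st_hmap)[Gt _] := st_.
  have Gw : mulf (leval cenv s) (finv (leval cenv t)) \inG.
    by apply: mem_mulf => //; exact: mem_finv.
  (* The shift by q.+2 keeps the variables of the terms off q.+1, which receives the quotient. *)
  have lv a w : (forall n, tfree n a -> lfree n (LEq s t)) ->
      levalG (upd env q.+1 w) (shift_term q.+2 a) = leval cenv a :> (O -> O).
    move=> sub; apply: leval_shift => n /sub/e[_ <-]; rewrite updN //; apply/eqP; lia.
  have lvs := lv s _ (fun n nt => introT orP (or_introl nt)).
  have lvt := lv t _ (fun n nt => introT orP (or_intror nt)).
  have trE w : w \inG -> (lsatG (upd env q.+1 w) (ftriv q q.+1 q.+2) <->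
      forall x, R c x -> near G R x (w x)).
    move=> Gw'; apply: iff_trans (ftrivP _ _ _) _; try lia; first exact: upd_P.
    by rewrite updE upd_lt ?eq //; exact: trivP.
  split=> [nr|[w [Gw' [ew /(trE w Gw') nr]]] x Rx].
    eexists; split; first exact: Gw.
    by split; [move=> x /=; rewrite updE lvs lvt | apply/trE].
  by move: (ew x) (nr x Rx); rewrite /= updE lvs lvt => ->.
- by rewrite /= (IH env).
- by rewrite /= (IHr env) ?(IHu env) // => n nt; apply: e; rewrite /= nt ?orbT.
- by rewrite /= (IHr env) ?(IHu env) // => n nt; apply: e; rewrite /= nt ?orbT.
- by rewrite /= (IHr env) ?(IHu env) // => n nt; apply: e; rewrite /= nt ?orbT.
- split=> H a.
    move=> Ga /(bind env m a Ge eq Ga) ha; have sa : st G (R c) a by apply/st_hmap.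
    apply/(IH _ (upd cenv m a)); [exact: upd_P | by rewrite upd_lt //; lia | exact: up | exact: H].
  move=> sa; have /st_hmap[Ga ha] := sa.
  apply/(IH (upd env (m + q.+2) a)); [exact: upd_P | by rewrite upd_lt //; lia | exact: up |].
  by apply: H => //; apply/bind.
split=> -[a].
  move=> [sa H]; have /st_hmap[Ga ha] := sa; exists a; split=> //; split; first exact/bind.
  apply/(IH _ (upd cenv m a)); [exact: upd_P | by rewrite upd_lt //; lia | exact: up | exact: H].
move=> [Ga [/(bind env m a Ge eq Ga) ha H]]; have sa : st G (R c) a by apply/st_hmap.
exists a; split=> //.
by apply/(IH (upd env (m + q.+2) a)); [exact: upd_P | rewrite upd_lt //; lia | exact: up |].
Qed.

Lemma component_sentenceP q p env : lsentence p -> (forall n, env n \inG) ->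
  env q = h -> (lmodels C p <-> lsatG env (component_form q p)).
Proof.
move=> sp Ge eq; have stid : st G (R c) id.
  by apply/stP => //; [exact: spine_block | split=> //; exact: lp_id].
apply: iff_trans (lmodels_sentence (M := C) (env := fun=> id) sp (fun=> stid)) _.
by apply: component_formP => // n; rewrite sp.
Qed.

End Component.

(** Allows environments to be matched by the equation [kappa G (env n) = cenv n]. *)
Lemma same_rel_eq (R S : O -> O -> Prop) : same_rel R S -> R = S.
Proof.
move=> RS; apply: functional_extensionality => x; apply: functional_extensionality => y.
exact: propositional_extensionality.
Qed.

Lemma tauE h : h \inG -> tau G h -> exists c, forall x, hull G h x <-> kappa G h c x.
Proof.
move=> Gh th; have [[c Hc] _ _] := blk_block trG Gh (proj1 th).
by exists c; exact: (proj2 (kappa_tau trG abG Gh th)).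
Qed.

Lemma tau_kappa R c : in_spine G R -> exists h, [/\ h \inG, tau G h,
  kappa G h = R & forall x, hull G h x <-> R c x].
Proof.
move=> sR; have [h [Gh th hE]] := tau_complete trG abG c sR.
by exists h; split=> //; apply: same_rel_eq; exact: kappa_same.
Qed.

(** * Interpretation of the spine *)

Section Spine.
Context (I : Type) (col : I -> (O -> O -> Prop) -> Prop) (fcol : I -> nat -> lform).
Context (fcolP : forall i n env, (forall k, env k \inG) -> tau G (env n) ->
  (lsatG env (fcol i n) <-> col i (kappa G (env n)))).
Local Notation S := (spine_cstruct G col).

Lemma spine_formP p env (cenv : nat -> cs_car S) : (forall n, env n \inG) ->
  (forall n, cfree n p -> tau G (env n) /\ kappa G (env n) = cenv n) ->
  (csat cenv p <-> lsatG env (spine_form fcol p)).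
Proof.
have up r env1 (cenv1 : nat -> cs_car S) m a : tau G a ->
    (forall n, (m != n) && cfree n r -> tau G (env1 n) /\ kappa G (env1 n) = cenv1 n) ->
    forall n, cfree n r -> tau G (upd env1 m a n) /\
      kappa G (upd env1 m a n) = upd cenv1 m (kappa G a) n.
  move=> ta e n nr; rewrite /upd; case: eqP => // nm; apply: e.
  by rewrite nr andbT; apply/eqP => mn; apply: nm.
have bind env1 m a : (forall n, env1 n \inG) -> a \inG ->
    (lsatG (upd env1 m a) (ftau m m.+1) <-> tau G a).
  move=> Ge Ga; apply: iff_trans (ftauP _ _) _; try lia; first exact: upd_P.
  by rewrite updE.
have le_ a b n env1 : (forall n, env1 n \inG) -> tau G (env1 a) -> tau G (env1 b) ->
    (a < n)%N -> (b < n)%N -> (lsatG env1 (fhle a b n) <->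
      forall x y, kappa G (env1 a) x y -> kappa G (env1 b) x y).
  move=> Ge ta tb an bn; apply: iff_trans (fhleP Ge an bn) _.
  exact: hle_kappa.
(* Any point selects a class of R; a generating pair of R supplies one. *)
have pt (R : O -> O -> Prop) : in_spine G R -> exists a, [/\ a \inG, tau G a & kappa G a = R].
  by case=> a [b sR]; have [|h [Gh th e _]] := @tau_kappa R a; [exists a, b | exists h].
elim: p env cenv => [a b|a b|i a|//|r IH|r IHr u IHu|r IHr u IHu|r IHr u IHu|m r IH|m r IH]
  env cenv Ge e.
- have [ta ea] : tau G (env a) /\ kappa G (env a) = cenv a by apply: e; rewrite /= eqxx.
  have [tb eb] : tau G (env b) /\ kappa G (env b) = cenv b by apply: e; rewrite /= eqxx orbT.
  by apply: iff_sym; rewrite /= -ea -eb; apply: le_ => //; lia.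
- have [ta ea] : tau G (env a) /\ kappa G (env a) = cenv a by apply: e; rewrite /= eqxx.
  have [tb eb] : tau G (env b) /\ kappa G (env b) = cenv b by apply: e; rewrite /= eqxx orbT.
  rewrite /= -ea -eb; apply: iff_sym.
  have [an bn] : (a < (maxn a b).+1)%N /\ (b < (maxn a b).+1)%N by lia.
  apply: iff_trans (sat_and (le_ _ _ _ _ Ge ta tb an bn) (le_ _ _ _ _ Ge tb ta bn an)) _.
  by split=> [[H H'] x y|H]; [split=> [/H|/H'] | split=> x y /H].
- have [ta ea] : tau G (env a) /\ kappa G (env a) = cenv a by apply: e; rewrite /= eqxx.
  by rewrite /= -ea fcolP.
- by rewrite /= (IH env).
- by rewrite /= (IHr env) ?(IHu env) // => n nt; apply: e; rewrite /= nt ?orbT.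
- by rewrite /= (IHr env) ?(IHu env) // => n nt; apply: e; rewrite /= nt ?orbT.
- by rewrite /= (IHr env) ?(IHu env) // => n nt; apply: e; rewrite /= nt ?orbT.
- split=> H a.
    move=> Ga /(bind env m a Ge Ga) ta.
    apply/(IH _ (upd cenv m (kappa G a))); [exact: upd_P | exact: up |].
    by apply: H; exact: (proj1 (kappa_tau trG abG Ga ta)).
  move=> /pt[h [Gh th <-]].
  by apply/(IH (upd env m h)); [exact: upd_P | exact: up | apply: H => //; exact/bind].
split=> -[a].
  move=> [/pt[h [Gh th <-]] H]; exists h; split=> //; split; first exact/bind.
  by apply/(IH _ (upd cenv m (kappa G h))); [exact: upd_P | exact: up |].
move=> [Ga [/(bind env m a Ge Ga) ta H]]; exists (kappa G a); split.
  exact: (proj1 (kappa_tau trG abG Ga ta)).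
by apply/(IH (upd env m a)); [exact: upd_P | exact: up |].
Qed.

(* [cmodels] holds vacuously when the spine is empty, whence the premise. *)
Lemma spine_sentenceP p : csentence p ->
  (cmodels S p <-> lmodels (lgroup G) (LImp (LEx 0 (ftau 0 1)) (spine_form fcol p))).
Proof.
move=> sp; split=> [H env Ge [h [Gh th]]|H cenv De].
  have {}th : tau G h.
    have /= := proj1 (ftauP (env := upd env 0 h) (n := 1) (h := 0) _ _) th.
    by rewrite updE; apply=> //; exact: upd_P.
  apply/(spine_formP (cenv := fun=> kappa G h)) => //; first by move=> n; rewrite sp.
  by apply: H => n; exact: (proj1 (kappa_tau trG abG Gh th)).
apply/(spine_formP (env := fun=> id)); [by move=> n; exact: lp_id | by move=> n; rewrite sp |].
apply: H; first by move=> n; exact: lp_id.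
have [c _] := De 0; have [h [Gh th _ _]] := tau_kappa c (De 0).
exists h; split=> //; apply/ftauP => //; by apply: upd_P => // n; exact: lp_id.
Qed.

End Spine.

Lemma spine_chainP p : csentence p -> (cmodels (spine_chain G) p <->
  lmodels (lgroup G) (LImp (LEx 0 (ftau 0 1))
    (spine_form (fun (i : False) _ => match i with end) p))).
Proof. by apply: spine_sentenceP => -[]. Qed.

(** By [hle_kappa] the guard selects the parameters with the same [kappa] as [env n], and by
    [tau_kappa] their hulls run through all its classes. *)
Lemma colour_formP (s : lsent) n env : (forall k, env k \inG) -> tau G (env n) ->
  (lsatG env (colour_form s n) <->
   forall c, lmodels (component G (kappa G (env n)) c) (proj1_sig s)).
Proof.
move=> Ge tn; have [sR _] := kappa_tau trG abG (Ge n) tn.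
have guard h : h \inG -> (lsatG (upd env n.+1 h)
    (LAnd (ftau n.+1 n.+2) (LAnd (fhle n n.+1 n.+2) (fhle n.+1 n n.+2))) <->
    tau G h /\ (hle G (env n) h /\ hle G h (env n))).
  move=> Gh; have Ge' k : upd env n.+1 h k \inG by exact: upd_P.
  apply: sat_and; last apply: sat_and.
  - by apply: iff_trans (ftauP Ge' _) _; rewrite ?updE.
  - by apply: iff_trans (fhleP Ge' _ _) _; rewrite ?updE ?upd_lt.
  by apply: iff_trans (fhleP Ge' _ _) _; rewrite ?updE ?upd_lt.
split=> [H c|H h Gh /(guard h Gh)[th [le ge]]].
  have [h [Gh th ek hE]] := tau_kappa c sR.
  apply/(component_sentenceP (q := n.+1) (env := upd env n.+1 h) sR Gh hE) => //.
  - exact: proj2_sig.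
  - exact: upd_P.
  - by rewrite updE.
  apply: (H h Gh); apply/guard => //; split=> //.
  by split; apply/(hle_kappa trG) => //; rewrite ek.
have ek : kappa G h = kappa G (env n).
  apply: same_rel_eq => x y.
  split; first exact: (proj1 (hle_kappa trG Gh (Ge n) th tn) ge).
  exact: (proj1 (hle_kappa trG (Ge n) Gh tn th) le).
have [c hE] := tauE Gh th; rewrite ek in hE.
apply/(component_sentenceP sR Gh hE) => //; [exact: proj2_sig | exact: upd_P | by rewrite updE].
Qed.

(** Having an irreducible element is one sentence about the component, so it can be relativised to
    each parameter. *)
Lemma irreducible_componentsP : irreducible_components G <->
  lmodels (lgroup G) (LAll 0 (LImp (ftau 0 1) (component_form 0 irreducible_form))).
Proof.
have irrP R c : in_spine G R -> (lmodels (component G R c) irreducible_form <->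
    exists g, st G (R c) g /\ @irreducible (component G R c) g).
  move=> sR; have stid : st G (R c) id.
    by apply/stP => //; [exact: spine_block | split=> //; exact: lp_id].
  apply: iff_trans (lmodels_sentence (M := component G R c) (env := fun=> id)
    irreducible_sentence (fun=> stid)) _.
  exact: irreducible_formP.
split=> [H env Ge h Gh|H R sR c].
  have Ge' k : upd env 0 h k \inG by exact: upd_P.
  move=> /(ftauP Ge' (ltn0Sn 0)); rewrite updE => th.
  have [sR _] := kappa_tau trG abG Gh th; have [c hE] := tauE Gh th.
  apply: (proj1 (component_sentenceP sR Gh hE irreducible_sentence Ge' (updE _ _ _))).
  by apply/irrP => //; exact: H.
have [h [Gh th ek hE]] := tau_kappa c sR.
apply/irrP => //.
have Ge' k : upd (fun=> id) 0 h k \inG by apply: upd_P => // ?; exact: lp_id.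
apply: (proj2 (component_sentenceP sR Gh hE irreducible_sentence Ge' (updE _ _ _))).
by apply: (H (fun=> id)) => //; [move=> n; exact: lp_id | apply/ftauP].
Qed.

End Transfer.

Theorem theoremA
  (d1 : Order.disp_t) (O1 : orderType d1) (G : lperm O1)
  (d2 : Order.disp_t) (O2 : orderType d2) (H : lperm O2) :
  ltransitive G -> ltransitive H ->
  abundant G -> abundant H ->
  dagger G -> dagger H ->
  irreducible_components G ->
  lequiv (lgroup G) (lgroup H) ->
  [/\ irreducible_components H,
      cequiv (spine_chain G) (spine_chain H) &
      (controlled G -> cequiv (coloured_chain G) (coloured_chain H))].
Proof.
move=> trG trH abG abH _ _ irrG GH; split.
(* Each assertion is equivalent to a formula that is the same for G and H. *)
- apply/irreducible_componentsP => //; apply/(lequiv_formula _ GH).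
  exact/irreducible_componentsP.
- move=> p sp; rewrite (spine_chainP trG abG sp) (spine_chainP trH abH sp).
  exact: lequiv_formula.
move=> _ p sp; rewrite (spine_sentenceP trG abG (colour_formP trG abG) sp).
rewrite (spine_sentenceP trH abH (colour_formP trH abH) sp).
exact: lequiv_formula.
Qed.
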